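(* Let $r\ge2$ and suppose Assumption D (stated in the context) holds for the two-network bilinear zero-sum game $$\min_{\bm x\in X}\max_{\bm y\in Y}\ U(\bm x,\bm y)\quad\text{s.t.}\quad\bm L_1\bm x=0_{pn_1},\ \bm L_2\bm y=0_{qn_2}.\qquad (Q)$$ Let $(\bm x(t),\bm u(t),\bm\lambda(t),\bm\tau(t),\bm y(t),\bm v(t),\bm\mu(t),\bm\nu(t))$ be a trajectory of the dynamics (D2) of the context, and let $(\bm x^\star,\bm u^\star,\bm\lambda^\star,\bm\tau^\star,\bm y^\star,\bm v^\star,\bm\mu^\star,\bm\nu^\star)$ be an equilibrium point of (D2), where $(\bm x^\star,\bm\lambda^\star,\bm y^\star,\bm\mu^\star)$ is a saddle point of $S_2$ and $(\bm x^\star,\bm y^\star)$ is the Nash equilibrium of (Q). Then: (i) the duality gap $S_2(\bm x(t),\bm\lambda^\star,\bm y^\star,\bm\mu(t))-S_2(\bm x^\star,\bm\lambda(t),\bm y(t),\bm\mu^\star)$ converges to $0$ with a rate of $\mathcal O(1/t^2)$; (ii) $(\bm x(t),\bm y(t))$ converges to $(\bm x^\star,\bm y^\star)$ as $t\to\infty$; (iii) $\Vert\bm L_1\bm x(t)\Vert$, $\Vert\bm L_2\bm y(t)\Vert$ and $|U(\bm x(t),\bm y^\star)-U(\bm x^\star,\bm y(t))|$ all converge to $0$ with a rate of $\mathcal O(1/t)$.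
   Context: $\mathcal G_1,\mathcal G_2$ are undirected connected graphs with node sets $\mathcal V_1=\{1,\dots,n_1\}$, $\mathcal V_2=\{1,\dots,n_2\}$, symmetric adjacency matrices with positive weights exactly on edges, and Laplacians $\mathcal L_1,\mathcal L_2$ (degree matrix minus adjacency matrix). $\bm L_1=\mathcal L_1\otimes I_p$, $\bm L_2=\mathcal L_2\otimes I_q$. $X=X_1\times\dots\times X_{n_1}$ with $X_i\subset\mathbb R^p$, $Y=Y_1\times\dots\times Y_{n_2}$ with $Y_j\subset\mathbb R^q$ (nonempty closed convex sets). Stacked vectors: $\bm x,\bm u,\bm\lambda,\bm\tau\in\mathbb R^{pn_1}$ with blocks $x_i,u_i,\lambda_i,\tau_i\in\mathbb R^p$; $\bm y,\bm v,\bm\mu,\bm\nu\in\mathbb R^{qn_2}$ with blocks $y_j,v_j,\mu_j,\nu_j\in\mathbb R^q$. Payoff: $U(\bm x,\bm y)=\sum_{i\in\mathcal V_1}f_i(x_i)+\bm x^{\rm T}B\bm y-\sum_{j\in\mathcal V_2}g_j(y_j)$, where $\bm x^{\rm T}B\bm y=\sum_{i\in\mathcal V_1}\sum_{j\in\mathcal V_2}x_i^{\rm T}H_{ij}y_j$ with given $H_{ij}\in\mathbb R^{p\times q}$. A Nash equilibrium of (Q) is a pair $(\bm x^\star,\bm y^\star)\in\Omega_1\times\Omega_2$, $\Omega_1=\{\bm x\in X:x_1=\dots=x_{n_1}\}$, $\Omega_2=\{\bm y\in Y:y_1=\dots=y_{n_2}\}$, with $U(\bm x^\star,\bm y)\le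 U(\bm x^\star,\bm y^\star)\le U(\bm x,\bm y^\star)$ for all $\bm x\in\Omega_1,\bm y\in\Omega_2$. Assumption D: for each $i\in\mathcal V_1$, $j\in\mathcal V_2$, $f_i$ and $g_j$ are continuously differentiable and strictly convex on open sets containing $X_i$ and $Y_j$, respectively, with gradients Lipschitz continuous over $X_i$ and $Y_j$; Slater's condition holds (there are $\bm x$ in the relative interior of $X$ with $\bm L_1\bm x=0$ and $\bm y$ in the relative interior of $Y$ with $\bm L_2\bm y=0$); there exists a unique Nash equilibrium. $S_2(\bm x,\bm\lambda,\bm y,\bm\mu):=U(\bm x,\bm y)+\bm\lambda^{\rm T}\bm L_1\bm x-\bm\mu^{\rm T}\bm L_2\bm y+\frac12\bm x^{\rm T}\bm L_1\bm x-\frac12\bm y^{\rm T}\bm L_2\bm y$, minimized over $(\bm x,\bm\mu)\in X\times\mathbb R^{qn_2}$ and maximized over $(\bm y,\bm\lambda)\in Y\times\mathbb R^{pn_1}$; saddle point means $S_2(\bm x^\star,\bm\lambda,\bm y,\bm\mu^\star)\le S_2(\bm x^\star,\bm\lambda^\star,\bm y^\star,\bm\mu^\star)\le S_2(\bm x,\bm\lambda^\star,\bm y^\star,\bm\mu)$ for all such $\bm x,\bm\lambda,\bm y,\bm\mu$. Generating functions: $\psi_i:\mathbb R^p\to\mathbb R\cup\{\infty\}$ and $\phi_j:\mathbb R^q\to\mathbb R\cup\{\infty\}$ are proper, closed, strongly convex with ${\rm dom}(\psi_i)=X_i$, ${\rm dom}(\phi_j)=Y_j$, continuously differentiable with Lipschitz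 gradients on their domains (each coincides on its domain with a function continuously differentiable on an open set containing the domain, whose gradient there is denoted $\nabla\psi_i$, $\nabla\phi_j$), and the gradients $\nabla\psi_i^*,\nabla\phi_j^*$ of the convex conjugates are Lipschitz; $\nabla\psi_i^*(u)={\rm argmin}_{x\in X_i}\{-x^{\rm T}u+\psi_i(x)\}$, similarly for $\phi_j^*$. Dynamics (D2), for $i\in\mathcal V_1$, $j\in\mathcal V_2$: $$\dot x_i=\tfrac rt[\nabla\psi_i^*(u_i)-x_i],\quad\dot\lambda_i=\tfrac rt[\tau_i-\lambda_i],\quad \dot y_j=\tfrac rt[\nabla\phi_j^*(v_j)-y_j],\quad\dot\mu_j=\tfrac rt[\nu_j-\mu_j],$$ $$\dot u_i=\tfrac tr\big[-\nabla_{x_i}S_2(\bm x,\bm\lambda+\tfrac tr\dot{\bm\lambda},\bm y+\tfrac tr\dot{\bm y},\bm\mu)+\nabla\psi_i(x_i+\tfrac tr\dot x_i)-u_i\big],$$ $$\dot\tau_i=\tfrac tr\big[\nabla_{\lambda_i}S_2(\bm x+\tfrac tr\dot{\bm x},\bm\lambda,\bm y,\bm\mu)+\lambda_i+\tfrac tr\dot\lambda_i-\tau_i\big],$$ $$\dot v_j=\tfrac tr\big[\nabla_{y_j}S_2(\bm x+\tfrac tr\dot{\bm x},\bm\lambda,\bm y,\bm\mu+\tfrac tr\dot{\bm\mu})+\nabla\phi_j(y_j+\tfrac tr\dot y_j)-v_j\big],$$ $$\dot\nu_j=\tfrac tr\big[-\nabla_{\mu_j}S_2(\bm x,\bm\lambda,\bm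 y+\tfrac tr\dot{\bm y},\bm\mu)+\mu_j+\tfrac tr\dot\mu_j-\nu_j\big],$$ with $x_i(0)=\nabla\psi_i^*(u_{i,0})$, $u_i(0)=u_{i,0}\in X_i$, $\lambda_i(0)=\tau_i(0)=\tau_{i,0}\in\mathbb R^p$, $y_j(0)=\nabla\phi_j^*(v_{j,0})$, $v_j(0)=v_{j,0}\in Y_j$, $\mu_j(0)=\nu_j(0)=\nu_{j,0}\in\mathbb R^q$. A trajectory is a tuple of functions continuous on $[0,\infty)$ and differentiable on $(0,\infty)$, satisfying the differential equations for $t>0$ and the initial conditions at $t=0$. An equilibrium point is a constant tuple at which all brackets vanish with all derivatives set to zero. A nonnegative quantity $g(t)$ converges to $0$ with rate $\mathcal O(1/t^k)$ if there is a constant $C$ (independent of $t$) with $g(t)\le C/t^k$ for all sufficiently large $t$. *)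

(* Defs.v *)
From mathcomp Require Export all_boot all_order all_algebra.
From mathcomp Require Export mxtens.
From mathcomp Require Export all_classical all_reals all_analysis.
Export numFieldNormedType.Exports.

Set Implicit Arguments.
Unset Strict Implicit.
Unset Printing Implicit Defensive.

Import Order.TTheory GRing.Theory Num.Theory.
Local Open Scope classical_set_scope.
Local Open Scope ring_scope.

Section EuclideanSpace.
Context {R : realType} {p : nat}.
Implicit Types (A : set 'cV[R]_p) (f : 'cV[R]_p -> R) (h : 'cV[R]_p -> \bar R).

Definition dot (u v : 'cV[R]_p) : R := (u^T *m v) 0 0.

(* The Euclidean norm; the library's norm on matrices is the sup norm.  The
   topological notions used below (continuity, differentiability, convergence,
   existence of a Lipschitz constant) do not depend on this choice. *)
Definition enorm (v : 'cV[R]_p) : R := Num.sqrt (dot v v).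

Definition grad f (x : 'cV[R]_p) : 'cV[R]_p :=
  \col_k 'D_(delta_mx k 0) f x.

Definition C1_on A f : Prop :=
  open A /\
  forall x, A x -> differentiable f x /\ {for x, continuous (grad f)}.

Definition strictly_convex_on A f : Prop :=
  @convex_set R 'cV[R]_p A /\
  forall x y (t : R), A x -> A y -> x <> y -> 0 < t < 1 ->
    f (t *: x + (1 - t) *: y) < t * f x + (1 - t) * f y.

Definition affine_set A : Prop :=
  forall x y (t : R), A x -> A y -> A (t *: x + (1 - t) *: y).

Definition affine_hull A : set 'cV[R]_p := smallest affine_set A.

Definition relative_interior A : set 'cV[R]_p :=
  [set x | A x /\ \forall y \near x, affine_hull A y -> A y].

Definition edom h : set 'cV[R]_p := [set x | (h x < +oo)%E].

Definition proper_fun h : Prop := edom h !=set0 /\ forall x, (-oo < h x)%E.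

Definition closed_fun h : Prop :=
  closed [set z : 'cV[R]_p * R | (h z.1 <= z.2%:E)%E].

Definition strongly_convex h : Prop :=
  exists2 c : R, 0 < c & forall x y (t : R), 0 < t < 1 ->
    (h (t *: x + (1 - t) *: y)%R
       + (c / 2 * (t * (1 - t)) * enorm (x - y) ^+ 2)%:E
     <= t%:E * h x + (1 - t)%:E * h y)%E.

Definition conjugate h (u : 'cV[R]_p) : \bar R :=
  ereal_sup [set ((dot x u)%:E - h x)%E | x in [set: 'cV[R]_p]].

(* Meaningful when the conjugate is finite everywhere, as is required in
   [generating] below. *)
Definition grad_conjugate h : 'cV[R]_p -> 'cV[R]_p := grad (fine \o conjugate h).

(* [hE] is the continuously differentiable function that coincides with [h] on
   its domain [A]; the gradient of [h] on [A] means [grad hE], which [h] alone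
   does not determine when [A] has empty interior. *)
Record generating A h (hE : 'cV[R]_p -> R) : Prop := Generating {
  generating_proper : proper_fun h;
  generating_closed : closed_fun h;
  generating_strongly_convex : strongly_convex h;
  generating_dom : edom h = A;
  generating_ext : exists O, [/\ A `<=` O, C1_on O hE &
    forall x, A x -> h x = (hE x)%:E];
  generating_lipschitz : [lipschitz grad hE x | x in A];
  generating_conj_fin : forall u, conjugate h u \is a fin_num;
  generating_conj_diff : forall u, differentiable (fine \o conjugate h) u;
  generating_conj_lipschitz : lipschitz (grad_conjugate h)
}.

End EuclideanSpace.

Section StackedVectors.
Context {R : realType} {n p : nat}.

(* A stacked vector has coordinate k of its block i at [mxtens_index (i, k)], the
   row indexing of the Kronecker product [*t]. *)
Definition block (i : 'I_n) (v : 'cV[R]_(n * p)) : 'cV[R]_p :=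
  \col_k v (mxtens_index (i, k)) 0.

Definition product_set (A : 'I_n -> set 'cV[R]_p) : set 'cV[R]_(n * p) :=
  [set v | forall i, A i (block i v)].

Definition consensus_set (A : 'I_n -> set 'cV[R]_p) : set 'cV[R]_(n * p) :=
  [set v | product_set A v /\ forall i j, block i v = block j v].

End StackedVectors.

(* [e] is the adjacency relation of a connected undirected graph and [A] a
   weighted adjacency matrix of it.  Self-loops would not affect the Laplacian
   and are not excluded. *)
Record connected_weighted_graph (R : realType) (n : nat) (e : rel 'I_n)
    (A : 'M[R]_n) : Prop := ConnectedWeightedGraph {
  graph_undirected : symmetric e;
  graph_connected : forall i j, connect e i j;
  adjacency_symmetric : A^T = A;
  adjacency_edge : forall i j, e i j -> 0 < A i j;
  adjacency_nonedge : forall i j, ~~ e i j -> A i j = 0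
}.

Definition laplacian (R : realType) (n : nat) (A : 'M[R]_n) : 'M[R]_n :=
  diag_mx (\row_i \sum_j A i j) - A.

Record game (R : realType) (n1 n2 p q : nat) := Game {
  edge1 : rel 'I_n1;
  edge2 : rel 'I_n2;
  adj1 : 'M[R]_n1;
  adj2 : 'M[R]_n2;
  setX : 'I_n1 -> set 'cV[R]_p;
  setY : 'I_n2 -> set 'cV[R]_q;
  costf : 'I_n1 -> 'cV[R]_p -> R;
  costg : 'I_n2 -> 'cV[R]_q -> R;
  coupling : 'I_n1 -> 'I_n2 -> 'M[R]_(p, q)
}.

(* The generating functions, with their continuously differentiable
   extensions (see [generating]). *)
Record generators (R : realType) (n1 n2 p q : nat) := Generators {
  psi : 'I_n1 -> 'cV[R]_p -> \bar R;
  psiE : 'I_n1 -> 'cV[R]_p -> R;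
  phi : 'I_n2 -> 'cV[R]_q -> \bar R;
  phiE : 'I_n2 -> 'cV[R]_q -> R
}.

Section Game.
Context {R : realType} {n1 n2 p q : nat}.
Variable G : game R n1 n2 p q.

Implicit Types (x l : 'cV[R]_(n1 * p)) (y m : 'cV[R]_(n2 * q)).

Definition L1 : 'M[R]_(n1 * p) := laplacian (adj1 G) *t (1%:M : 'M[R]_p).
Definition L2 : 'M[R]_(n2 * q) := laplacian (adj2 G) *t (1%:M : 'M[R]_q).

Definition payoff x y : R :=
  \sum_i costf G i (block i x)
  + \sum_i \sum_j dot (block i x) (coupling G i j *m block j y)
  - \sum_j costg G j (block j y).

Definition is_game : Prop :=
  [/\ connected_weighted_graph (edge1 G) (adj1 G),
      connected_weighted_graph (edge2 G) (adj2 G),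
      forall i, [/\ setX G i !=set0, closed (setX G i) &
                    @convex_set R 'cV[R]_p (setX G i)] &
      forall j, [/\ setY G j !=set0, closed (setY G j) &
                    @convex_set R 'cV[R]_q (setY G j)]].

Definition nash_equilibrium x y : Prop :=
  [/\ consensus_set (setX G) x, consensus_set (setY G) y &
    forall x' y', consensus_set (setX G) x' -> consensus_set (setY G) y' ->
      payoff x y' <= payoff x y <= payoff x' y].

Record assumptionD : Prop := AssumptionD {
  costf_regular : forall i, (exists O, [/\ setX G i `<=` O,
      C1_on O (costf G i) & strictly_convex_on O (costf G i)]) /\
    [lipschitz grad (costf G i) x | x in setX G i];
  costg_regular : forall j, (exists O, [/\ setY G j `<=` O,
      C1_on O (costg G j) & strictly_convex_on O (costg G j)]) /\
    [lipschitz grad (costg G j) y | y in setY G j];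
  slater : exists x y,
    [/\ relative_interior (product_set (setX G)) x, L1 *m x = 0,
        relative_interior (product_set (setY G)) y & L2 *m y = 0];
  nash_unique : exists! z, nash_equilibrium z.1 z.2
}.

Definition S2 x l y m : R :=
  payoff x y + dot l (L1 *m x) - dot m (L2 *m y)
  + 2^-1 * dot x (L1 *m x) - 2^-1 * dot y (L2 *m y).

Definition saddle_point xs ls ys ms : Prop :=
  [/\ product_set (setX G) xs, product_set (setY G) ys &
    forall x l y m, product_set (setX G) x -> product_set (setY G) y ->
      S2 xs l y ms <= S2 xs ls ys ms <= S2 x ls ys m].

Definition gradx i x l y m : 'cV[R]_p := block i (grad (fun a => S2 a l y m) x).
Definition gradl i x l y m : 'cV[R]_p := block i (grad (fun a => S2 x a y m) l).
Definition grady j x l y m : 'cV[R]_q := block j (grad (fun a => S2 x l a m) y).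
Definition gradm j x l y m : 'cV[R]_q := block j (grad (fun a => S2 x l y a) m).

Variable K : generators R n1 n2 p q.

Definition is_generators : Prop :=
  (forall i, generating (setX G i) (psi K i) (psiE K i)) /\
  (forall j, generating (setY G j) (phi K j) (phiE K j)).

(* The brackets of the dynamics.  A primed variable stands for the extrapolated
   one: x' is x + (t / r) dx/dt along a trajectory, and x at an equilibrium. *)
Definition bracket_x i x u : 'cV[R]_p :=
  grad_conjugate (psi K i) (block i u) - block i x.
Definition bracket_l (i : 'I_n1) l ta : 'cV[R]_p := block i ta - block i l.
Definition bracket_y j y v : 'cV[R]_q :=
  grad_conjugate (phi K j) (block j v) - block j y.
Definition bracket_m (j : 'I_n2) m nu : 'cV[R]_q := block j nu - block j m.
Definition bracket_u i x l' y' m x' u : 'cV[R]_p :=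
  - gradx i x l' y' m + grad (psiE K i) (block i x') - block i u.
Definition bracket_ta i x' l y m l' ta : 'cV[R]_p :=
  gradl i x' l y m + block i l' - block i ta.
Definition bracket_v j x' l y m' y' v : 'cV[R]_q :=
  grady j x' l y m' + grad (phiE K j) (block j y') - block j v.
Definition bracket_nu j x l y' m m' nu : 'cV[R]_q :=
  - gradm j x l y' m + block j m' - block j nu.

Definition regular_path N (z : R -> 'cV[R]_N) : Prop :=
  {within `[0, +oo[, continuous z} /\ forall t : R, 0 < t -> derivable z t 1.

Record trajectory (r : R) (x u l ta : R -> 'cV[R]_(n1 * p))
    (y v m nu : R -> 'cV[R]_(n2 * q)) : Prop := Trajectory {
  trajectory_regular1 :
    [/\ regular_path x, regular_path u, regular_path l & regular_path ta];
  trajectory_regular2 :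
    [/\ regular_path y, regular_path v, regular_path m & regular_path nu];
  trajectory_init1 : forall i,
    [/\ setX G i (block i (u 0)),
        block i (x 0) = grad_conjugate (psi K i) (block i (u 0)) &
        block i (l 0) = block i (ta 0)];
  trajectory_init2 : forall j,
    [/\ setY G j (block j (v 0)),
        block j (y 0) = grad_conjugate (phi K j) (block j (v 0)) &
        block j (m 0) = block j (nu 0)];
  trajectory_ode : forall t : R, 0 < t ->
    let x' := x t + (t / r) *: derive1 x t in
    let l' := l t + (t / r) *: derive1 l t in
    let y' := y t + (t / r) *: derive1 y t in
    let m' := m t + (t / r) *: derive1 m t in
    (forall i,
      [/\ block i (derive1 x t) = (r / t) *: bracket_x i (x t) (u t),
          block i (derive1 l t) = (r / t) *: bracket_l i (l t) (ta t),
          block i (derive1 u t) =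
            (t / r) *: bracket_u i (x t) l' y' (m t) x' (u t) &
          block i (derive1 ta t) =
            (t / r) *: bracket_ta i x' (l t) (y t) (m t) l' (ta t)]) /\
    (forall j,
      [/\ block j (derive1 y t) = (r / t) *: bracket_y j (y t) (v t),
          block j (derive1 m t) = (r / t) *: bracket_m j (m t) (nu t),
          block j (derive1 v t) =
            (t / r) *: bracket_v j x' (l t) (y t) m' y' (v t) &
          block j (derive1 nu t) =
            (t / r) *: bracket_nu j (x t) (l t) y' (m t) m' (nu t)])
}.

Definition equilibrium_point (x u l ta : 'cV[R]_(n1 * p))
    (y v m nu : 'cV[R]_(n2 * q)) : Prop :=
  (forall i, [/\ bracket_x i x u = 0, bracket_l i l ta = 0,
                 bracket_u i x l y m x u = 0 &
                 bracket_ta i x l y m l ta = 0]) /\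
  (forall j, [/\ bracket_y j y v = 0, bracket_m j m nu = 0,
                 bracket_v j x l y m y v = 0 &
                 bracket_nu j x l y m m nu = 0]).

End Game.

(* The lower bound is part of the definition: the O(1 / t ^ k) rates are those
   of nonnegative quantities, so that the bound forces convergence to 0. *)
Definition rate_O (R : realType) (k : nat) (g : R -> R) : Prop :=
  exists C : R, \forall t \near +oo, 0 <= g t <= C / t ^+ k.

(* Main.v *)
From HB Require Import structures.
From mathcomp Require Import ring lra.
Require Import Defs.

Set Implicit Arguments.
Unset Strict Implicit.
Unset Printing Implicit Defensive.

Import Order.TTheory GRing.Theory Num.Theory.
Local Open Scope classical_set_scope.
Local Open Scope ring_scope.

(* Write z' = z + (t/r) dz/dt.  The function
     V = (t/r)^2 (S2(x, ls, ys, m) - S2(xs, l, y, ms))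
         + D(u, us) + D(v, vs) + |ta - ls|^2 / 2 + |nu - ms|^2 / 2,
   with D the Bregman divergences of the conjugates of the generating functions,
   is nonincreasing for t > 0 when r >= 2, which bounds the duality gap by
   O(1/t^2).  The gap is the sum over the two players of the excess over its
   minimum, attained at xs (resp. ys), of a function F(x) + <x, L x> / 2 with F
   strictly convex.  As L xs = 0, already F is minimal at xs, so F(x) - F(xs)
   and <x, L x>, hence |L x|^2, are O(1/t^2).  Strict convexity turns
   F(x) -> F(xs) into x -> xs, and the payoff difference differs from the sum of
   the two excesses of F by <ls, L1 x> + <ms, L2 y> = O(1/t). *)

(** The equations are singular at t = 0, so the estimates start at t = 1 and the constant behind the
    rates is V(1). Feasibility of x(t) is a global fact: the first equation makes x a moving average
    of the points x', which lie in X. As x' may lie on the boundary of X, it satisfies only a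
    variational inequality instead of grad psi(x') = u; hence dV/dt is bounded, not computed. The
    condition r >= 2 absorbs the derivative (t/r)(2/r) of (t/r)^2. Only the sum of the two players'
    shares of V is shown to decrease. In the estimate of its own share each player keeps a work
    term, t/r times <x' - xs, B (y' - ys)>, with opposite signs for the two players. These cancel
    exactly because the coupling is bilinear and the dynamics evaluates both forces at extrapolated
    points. One network can thus be studied alone under an external force, and the other is the same
    object with signs changed. *)

Section DotProduct.
Context {R : realType} {n : nat}.
Implicit Types u v w : 'cV[R]_n.

Lemma dotE u v : dot u v = \sum_k u k 0 * v k 0.
Proof. by rewrite /dot mxE; apply: eq_bigr => k _; rewrite mxE. Qed.

Lemma dotC u v : dot u v = dot v u.
Proof. by rewrite !dotE; apply: eq_bigr => k _; rewrite mulrC. Qed.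

Lemma dotDl u v w : dot (u + v) w = dot u w + dot v w.
Proof. by rewrite /dot linearD /= mulmxDl mxE. Qed.

Lemma dotDr u v w : dot u (v + w) = dot u v + dot u w.
Proof. by rewrite dotC dotDl !(dotC u). Qed.

Lemma dotZl (a : R) u v : dot (a *: u) v = a * dot u v.
Proof. by rewrite /dot linearZ /= -scalemxAl mxE. Qed.

Lemma dotZr (a : R) u v : dot u (a *: v) = a * dot u v.
Proof. by rewrite dotC dotZl dotC. Qed.

Lemma dotNl u v : dot (- u) v = - dot u v.
Proof. by rewrite -scaleN1r dotZl mulN1r. Qed.

Lemma dotNr u v : dot u (- v) = - dot u v.
Proof. by rewrite dotC dotNl dotC. Qed.

Lemma dotBl u v w : dot (u - v) w = dot u w - dot v w.
Proof. by rewrite dotDl dotNl. Qed.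

Lemma dotBr u v w : dot u (v - w) = dot u v - dot u w.
Proof. by rewrite dotDr dotNr. Qed.

Lemma dot0r u : dot u 0 = 0.
Proof. by rewrite -(scale0r 0) dotZr mul0r. Qed.

Lemma dot0l u : dot 0 u = 0.
Proof. by rewrite dotC dot0r. Qed.

Lemma dot_ge0 u : 0 <= dot u u.
Proof. by rewrite dotE sumr_ge0 // => k _; rewrite -expr2 sqr_ge0. Qed.

Lemma dot_eq0 u : dot u u = 0 -> u = 0.
Proof.
rewrite dotE => /eqP; rewrite psumr_eq0 => [/allP h|k _]; last first.
  by rewrite -expr2 sqr_ge0.
apply/colP => k; rewrite mxE.
by have := h k (mem_index_enum k); rewrite -expr2 sqrf_eq0 => /eqP.
Qed.

Lemma dot_delta u k : dot u (delta_mx k 0) = u k 0.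
Proof.
rewrite dotE (bigD1 k) //= mxE !eqxx mulr1 big1 ?addr0 // => i ik.
by rewrite mxE (negbTE ik) mulr0.
Qed.

Lemma dot_sumr (I : Type) (s : seq I) (P : pred I) (F : I -> 'cV[R]_n) u :
  dot u (\sum_(i <- s | P i) F i) = \sum_(i <- s | P i) dot u (F i).
Proof. by elim/big_rec2: _ => [|i a b _ <-]; rewrite ?dot0r ?dotDr. Qed.

Lemma enorm_ge0 u : 0 <= enorm u.
Proof. exact: sqrtr_ge0. Qed.

End DotProduct.

Lemma dot_mulmx (R : realType) m n (A : 'M[R]_(m, n)) (u : 'cV_m) (v : 'cV_n) :
  dot u (A *m v) = dot (A^T *m u) v.
Proof. by rewrite /dot trmx_mul trmxK mulmxA. Qed.

(** * Blocks of stacked vectors and Kronecker products with an identity *)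

Section Blocks.
Context {R : realType} {n p : nat}.
Implicit Types u v : 'cV[R]_(n * p).

Fact block_is_linear i : linear (@block R n p i).
Proof. by move=> a u v; apply/colP => k; rewrite !mxE. Qed.

HB.instance Definition _ (i : 'I_n) :=
  GRing.isLinear.Build R 'cV[R]_(n * p) 'cV[R]_p _ (block i)
    (block_is_linear i).

Lemma block_inj u v : (forall i, block i u = block i v) -> u = v.
Proof.
move=> uv; apply/colP => k; case: k / (mxtens_indexP k) => i j.
by move/colP: (uv i) => /(_ j); rewrite !mxE.
Qed.

Definition stack (f : 'I_n -> 'cV[R]_p) : 'cV[R]_(n * p) :=
  \col_k f (mxtens_unindex k).1 (mxtens_unindex k).2 0.

Lemma block_stack f i : block i (stack f) = f i.
Proof. by apply/colP => k; rewrite !mxE mxtens_indexK. Qed.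

Lemma sum_mxtens_index (F : 'I_(n * p) -> R) :
  \sum_k F k = \sum_i \sum_j F (mxtens_index (i, j)).
Proof.
rewrite pair_big /=; apply: reindex.
exists (@mxtens_unindex n p) => [[i j]|k] _.
  exact: mxtens_indexK.
by rewrite -surjective_pairing mxtens_unindexK.
Qed.

Lemma dot_block u v : dot u v = \sum_i dot (block i u) (block i v).
Proof.
rewrite dotE sum_mxtens_index; apply: eq_bigr => i _.
by rewrite dotE; apply: eq_bigr => j _; rewrite !mxE.
Qed.

Lemma block_tensmx1 (A : 'M[R]_n) u i :
  block i ((A *t (1%:M : 'M[R]_p)) *m u) = \sum_j A i j *: block j u.
Proof.
apply/colP => k; rewrite !mxE sum_mxtens_index summxE; apply: eq_bigr => j _.
rewrite !mxE (bigD1 k) //= tensmxE mxE eqxx mulr1 big1 ?addr0 // => l lk.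
by rewrite tensmxE mxE eq_sym (negbTE lk) mulr0 mul0r.
Qed.

End Blocks.

(** * Directional derivatives and gradients *)

Section Calculus.
Context {R : realType}.

(** Expanding the argument in the standard basis writes [f] as a finite sum of coordinate functions
    times fixed vectors. *)
Lemma linear_cV_continuous (W : normedModType R) n
  (f : {linear 'cV[R]_n -> W}) : continuous f.
Proof.
have -> : (f : 'cV_n -> W) =
    \sum_(k < n) (fun v => v k 0 *: f (delta_mx k 0)).
  apply/funext => v; rewrite fct_sumE {1}[v]matrix_sum_delta linear_sum /=.
  by apply: eq_bigr => k _; rewrite big_ord1 linearZ.
move=> v; elim/big_ind: _ => [|g h cg ch|k _]; first exact: cst_continuous.
  exact: continuousD.
apply: cvgZr_tmp; first exact: (nbhs_filter v).
exact: (@coord_continuous R n 1 k 0 v).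
Qed.

Context {V : normedModType R}.

Lemma is_derive_linear (W : normedModType R) n (f : {linear 'cV[R]_n -> W})
    (z : V -> 'cV[R]_n) x v dz :
  is_derive x v z dz -> is_derive x v (fun a => f (z a)) (f dz).
Proof.
move=> [zv zE]; have cf := @linear_cV_continuous _ _ f.
have h : h^-1 *: (f (z (h *: v + x)) - f (z x)) @[h --> 0^'] --> f dz.
  have := cvg_comp _ _ zv (cf ('D_v z x)); rewrite zE.
  by apply: cvg_trans; apply: near_eq_cvg; near=> s; rewrite /= linearZ linearB.
by split; [apply: cvgP h | exact: cvg_lim h].
Unshelve. all: by end_near. Qed.

End Calculus.

(** The codomain is [R^o], the field as a module over itself, so that facts about linear maps into
    normed modules apply. *)
Fact dot_is_linear (R : realType) n (u : 'cV[R]_n) :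
  linear (dot u : 'cV[R]_n -> R^o).
Proof. by move=> a v w; rewrite dotDr dotZr. Qed.

HB.instance Definition _ (R : realType) n (u : 'cV[R]_n) :=
  GRing.isLinear.Build R 'cV[R]_n R^o _ (dot u) (dot_is_linear u).

Section Derivatives.
Context {R : realType} {V : normedModType R}.
Implicit Types (f g : V -> R) (x v : V).

(* Applied forms of the library's [is_deriveD] and the like, which unify with
   goals about [fun a => f a + g a]. *)
Lemma is_derive_add f g x v (df dg : R) :
  is_derive x v f df -> is_derive x v g dg ->
  is_derive x v (fun a => f a + g a) (df + dg).
Proof. exact: is_deriveD. Qed.

Lemma is_derive_sub f g x v (df dg : R) :
  is_derive x v f df -> is_derive x v g dg ->
  is_derive x v (fun a => f a - g a) (df - dg).
Proof. exact: is_deriveB. Qed.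

Lemma is_derive_const (c : R) x v : is_derive x v (fun=> c) 0.
Proof. exact: is_derive_cst. Qed.

Lemma is_derive_scale f (c : R) x v (df : R) :
  is_derive x v f df -> is_derive x v (fun a => c * f a) (c * df).
Proof. exact: is_deriveZ. Qed.

Lemma is_derive_mul f g x v (df dg : R) :
  is_derive x v f df -> is_derive x v g dg ->
  is_derive x v (fun a => f a * g a) (df * g x + f x * dg).
Proof.
move=> hf hg; have := is_deriveM hf hg.
by rewrite addrC /GRing.scale /= (mulrC (g x)).
Qed.

Lemma is_derive_bigsum n (h : 'I_n -> V -> R) x v (dh : 'I_n -> R) :
  (forall i, is_derive x v (h i) (dh i)) ->
  is_derive x v (fun a => \sum_i h i a) (\sum_i dh i).
Proof.
move=> hh; have := is_derive_sum hh.
by congr is_derive; apply/funext => a; rewrite fct_sumE.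
Qed.

Lemma is_derive_dot n (a b : V -> 'cV[R]_n) x v da db :
  is_derive x v a da -> is_derive x v b db ->
  is_derive x v (fun s => dot (a s) (b s)) (dot da (b x) + dot (a x) db).
Proof.
move=> ha hb; under eq_fun do rewrite dotE.
rewrite !dotE -big_split /=; apply: is_derive_bigsum => k.
have coord (z : V -> 'cV[R]_n) dz : is_derive x v z dz ->
    is_derive x v (fun s => z s k 0) (dz k 0).
  move=> hz; have := is_derive_linear (dot (delta_mx k 0)) hz.
  by rewrite /= dotC dot_delta; under eq_fun do rewrite dotC dot_delta.
exact: is_derive_mul (coord _ _ ha) (coord _ _ hb).
Qed.

Lemma differentiable_dot n (a b : V -> 'cV[R]_n) x :
  differentiable a x -> differentiable b x ->
  differentiable (fun s => dot (a s) (b s)) x.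
Proof.
move=> ha hb; under eq_fun do rewrite dotE.
have -> : (fun s => \sum_k a s k 0 * b s k 0) =
    \sum_k ((fun s => a s k 0) * (fun s => b s k 0)).
  by apply/funext => s; rewrite fct_sumE.
apply: differentiable_sum => k; apply: differentiableM.
  apply: (differentiable_comp (g := fun M : 'cV[R]_n => M k 0)) => //.
  exact: differentiable_coord.
apply: (differentiable_comp (g := fun M : 'cV[R]_n => M k 0)) => //.
exact: differentiable_coord.
Qed.

Lemma differentiable_bigsum n (h : 'I_n -> V -> R) x :
  (forall i, differentiable (h i) x) ->
  differentiable (fun a => \sum_i h i a) x.
Proof.
move=> hh; have -> : (fun a => \sum_i h i a) = \sum_i h i.
  by apply/funext => a; rewrite fct_sumE.
exact: differentiable_sum.
Qed.

(** The derivative is computed as a right-hand limit: at a point of a convex set, only steps 0 < s <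
    1 towards another point are known to stay in the set. *)
Lemma derive_le f x v (c : R) : derivable f x v ->
  (forall s, 0 < s < 1 -> f (x + s *: v) - f x <= s * c) -> 'D_v f x <= c.
Proof.
move=> fxv h; have := cvg_dnbhs_at_right fxv => fr.
rewrite /derive -(cvg_lim _ fr) //; apply: limr_le; first exact: cvgP fr.
near=> s; have s0 : 0 < s by [].
have s1 : s < 1 by near: s; exact: nbhs_right_lt.
rewrite /GRing.scale /= mulrC ler_pdivrMr // mulrC [_ + x]addrC.
by apply: h; rewrite s0 s1.
Unshelve. all: by end_near. Qed.

Lemma derive_ge f x v (c : R) : derivable f x v ->
  (forall s, 0 < s < 1 -> s * c <= f (x + s *: v) - f x) -> c <= 'D_v f x.
Proof.
move=> fxv h; rewrite -lerN2 -deriveN //.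
apply: derive_le => [|s s01]; first exact: derivableN.
have := h s s01; change ((- f) (x + s *: v)) with (- f (x + s *: v)).
by change ((- f) x) with (- f x); lra.
Qed.

Lemma derive_scale_dir f x v (a : R) :
  differentiable f x -> 'D_(a *: v) f x = a * 'D_v f x.
Proof. by move=> df; rewrite !deriveE // linearZ. Qed.

End Derivatives.

Section Gradient.
Context {R : realType} {n : nat}.
Implicit Types (f : 'cV[R]_n -> R) (x w : 'cV[R]_n).

Lemma differentiable_linear (W : normedModType R) (f : {linear 'cV[R]_n -> W})
  x : differentiable f x.
Proof. exact/linear_differentiable/linear_cV_continuous. Qed.

Lemma dot_grad f x w : differentiable f x -> dot w (grad f x) = 'D_w f x.
Proof.
move=> df; rewrite deriveE // {2}[w]matrix_sum_delta linear_sum dotE /=.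
apply: eq_bigr => k _; rewrite big_ord1 linearZ /= mxE.
by rewrite deriveE.
Qed.

Lemma is_derive_path f (z : R -> 'cV[R]_n) (t : R) dz :
  differentiable f (z t) -> is_derive t 1 z dz ->
  is_derive t 1 (fun s => f (z s)) ('D_dz f (z t)).
Proof.
move=> df [dz1 dzE].
have zd : differentiable z t by apply/derivable1_diffP.
split; first by apply/derivable1_diffP; exact: differentiable_comp.
rewrite deriveE; last exact: differentiable_comp.
by rewrite (@diff_comp _ _ _ _ z f) //= -(deriveE (1 : R) zd) dzE -deriveE.
Qed.

End Gradient.

Lemma convex_segment (R : realType) n (A : set 'cV[R]_n) x d (s : R) :
  @convex_set R 'cV[R]_n A -> A x -> A (x + d) -> 0 <= s <= 1 ->
  A (x + s *: d).
Proof.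
move=> cA Ax Ay /andP[s0 s1].
have := cA (x + d) x (Itv01 s0 s1) (mem_set Ay) (mem_set Ax).
move=> /set_mem.
rewrite (_ : x + s *: d = s *: (x + d) + (1 - s) *: x) //.
by rewrite scalerDr scalerBl scale1r addrAC addrCA subrr addr0.
Qed.

(** * Minimizers over closed sets intersected with boxes *)

Section Compactness.
Context {R : realType} {n : nat}.
Implicit Types (A : set 'cV[R]_n) (f : 'cV[R]_n -> R).

(** A product of segments is compact among row vectors, and [g] is the transposition, written as a
    sum to make its continuity visible. *)
Lemma box_compact (M : R) :
  compact [set v : 'cV[R]_n | forall k, `|v k 0| <= M].
Proof.
pose g (w : 'rV[R]_n) : 'cV[R]_n := \sum_(k < n) w 0 k *: delta_mx k 0.
have gE w k : g w k 0 = w 0 k.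
  rewrite /g summxE (bigD1 k) //= !mxE !eqxx mulr1 big1 ?addr0 // => i ik.
  by rewrite !mxE eq_sym (negbTE ik) mulr0.
have gc : continuous g.
  have -> : g = \sum_(k < n) (fun w : 'rV[R]_n => w 0 k *: delta_mx k 0).
    by apply/funext => w; rewrite fct_sumE.
  move=> v; elim/big_ind: _ => [|a b ca cb|k _]; first exact: cst_continuous.
    exact: continuousD.
  apply: cvgZr_tmp; first exact: (nbhs_filter v).
  exact: (@coord_continuous R 1 n 0 k v).
have -> : [set v : 'cV[R]_n | forall k, `|v k 0| <= M] =
    g @` [set w : 'rV[R]_n | forall k, `[-M, M]%classic (w ord0 k)].
  apply/seteqP; split => [v vM|_ [w wM <-] k] /=.
    exists (\row_k v k 0) => [k|]; last first.
      by apply/colP => k; rewrite gE mxE.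
    by rewrite /= mxE in_itv /= -ler_norml.
  by rewrite gE ler_norml; have := wM k; rewrite /= in_itv.
apply: continuous_compact; first exact: continuous_subspaceT.
apply: (@rV_compact _ _ (fun=> `[-M, M]%classic)) => _; exact: segment_compact.
Qed.

(** Boxes replace balls because the bounds on sublevel sets are obtained coordinate by
    coordinate. *)
Lemma box_min A f (M : R) : closed A ->
  {in A, continuous f} ->
  (exists2 x, A x & forall k, `|x k 0| <= M) ->
  exists x, [/\ A x, forall k, `|x k 0| <= M &
    forall y, A y -> (forall k, `|y k 0| <= M) -> f x <= f y].
Proof.
move=> cA cf [x0 Ax0 x0M].
pose B : set 'cV[R]_n := A `&` [set v | forall k, `|v k 0| <= M].
have cB : compact B.
  by apply: subclosed_compact (@box_compact M) _ => //;
    [apply: closedI => //; apply: compact_closed; [exact: norm_hausdorff|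
     exact: box_compact]|exact: subIsetr].
have [|x] := @compact_EVT_min _ _ f B (ex_intro _ x0 (conj Ax0 x0M)) cB.
  apply: continuous_in_subspaceT => x /set_mem[Ax _].
  by apply: cf; exact/mem_set.
move=> /set_mem[Ax xM] xmin; exists x; split => // y Ay yM.
by apply: xmin; apply/mem_set.
Qed.

End Compactness.

(** * Conjugates of generating functions and their Bregman divergences *)

Section Conjugate.
Context {R : realType} {p : nat}.
Variables (A : set 'cV[R]_p) (h : 'cV[R]_p -> \bar R) (hE : 'cV[R]_p -> R).
Hypotheses (hgen : generating A h hE) (Acl : closed A)
  (Acv : @convex_set R 'cV[R]_p A).
Let c := fine \o conjugate h.

Let hA x : A x -> h x = (hE x)%:E.
Proof. by have [D [_ _]] := generating_ext hgen; apply. Qed.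

Let hE_diff x : A x -> differentiable hE x.
Proof. by have [D [AD [_ C1] _]] := generating_ext hgen; move=> /AD /C1 []. Qed.

Lemma fenchel_young x u : A x -> dot x u - hE x <= c u.
Proof.
move=> Ax; rewrite -lee_fin /c /= fineK ?(generating_conj_fin hgen) //.
by apply: ereal_sup_ubound; exists x => //; rewrite hA.
Qed.

Lemma conjugate_le u (b : R) :
  (forall x, A x -> dot x u - hE x <= b) -> c u <= b.
Proof.
move=> ub; rewrite -lee_fin /c /= fineK ?(generating_conj_fin hgen) //.
apply: ge_ereal_sup => _ [x _ <-].
have [Ax|nAx] := pselect (A x); first by rewrite hA // lee_fin ub.
move: nAx; rewrite -(generating_dom hgen) /edom /= ltNge => /negP.
by rewrite negbK leye_eq => /eqP ->; rewrite addeNy leNye.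
Qed.

(* Finiteness of the conjugate at [u +- e_k] bounds the sublevel sets of
   [hE - dot _ u], so the supremum defining the conjugate is attained. *)
Lemma conjugate_attained u : exists2 x, A x & c u = dot x u - hE x.
Proof.
have [x0 Ax0] : A !=set0.
  by rewrite -(generating_dom hgen); case: (generating_proper hgen).
pose f x := hE x - dot x u.
pose M := `|f x0| + \sum_k (`|c (u + delta_mx k 0)| + `|c (u - delta_mx k 0)|).
have bnd x : A x -> f x <= f x0 -> forall k, `|x k 0| <= M.
  move=> Ax fx k.
  have := fenchel_young (u + delta_mx k 0) Ax.
  have := fenchel_young (u - delta_mx k 0) Ax.
  rewrite !dotDr dotNr !dot_delta /M (bigD1 k) //=.
  have := ler_norm (f x0); have := ler_norm (c (u + delta_mx k 0)).
  have := ler_norm (c (u - delta_mx k 0)).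
  have : 0 <= \sum_(i < p | i != k)
      (`|c (u + delta_mx i 0)| + `|c (u - delta_mx i 0)|).
    by apply: sumr_ge0 => i _; rewrite addr_ge0.
  have := normr_ge0 (c (u + delta_mx k 0)).
  have := normr_ge0 (c (u - delta_mx k 0)).
  move: fx; rewrite /f ler_norml; move: (\sum_(i < p | _) _) => S.
  by move=> *; apply/andP; split; lra.
have [||x [Ax _ xmin]] := @box_min R p A f M Acl.
- move=> x /set_mem Ax; apply: differentiable_continuous.
  apply: differentiableB; first exact: hE_diff.
  by apply: differentiable_dot => //; exact: differentiable_cst.
- by exists x0 => //; exact: bnd.
exists x => //; apply/eqP; rewrite eq_le fenchel_young // andbT.
apply: conjugate_le => y Ay.
have fx0 : f x <= f x0 by apply: xmin => //; exact: bnd.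
suff : f x <= f y by rewrite /f; lra.
have [yx0|/ltW] := leP (f y) (f x0); last exact: le_trans.
by apply: xmin => //; exact: bnd.
Qed.

(** A point attaining the supremum at [u] is a subgradient of the conjugate there, by the
    Fenchel-Young inequality at nearby arguments. Differentiability leaves only one subgradient, the
    gradient. *)
Lemma grad_conjugateP u :
  A (grad_conjugate h u) /\
  c u = dot (grad_conjugate h u) u - hE (grad_conjugate h u).
Proof.
have [x Ax cx] := conjugate_attained u.
suff -> : grad_conjugate h u = x by [].
have cd := generating_conj_diff hgen u.
have ge w : dot x w <= 'D_w c u.
  apply: derive_ge => [|s _]; first exact: diff_derivable.
  have := fenchel_young (u + s *: w) Ax.
  by rewrite cx dotDr dotZr; lra.
apply/colP => k; rewrite mxE -dot_delta.
(* The subgradient inequality in the opposite direction gives the other bound. *)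
apply/eqP; rewrite eq_le ge andbT -lerN2 -dotNr.
by apply: le_trans (ge _) _; rewrite !deriveE // linearN.
Qed.

(** First-order optimality of [z], which minimizes [hE] minus the linear form of [u] over [A]. It is
    an inequality because [z] may be a boundary point. *)
Lemma grad_conjugate_variational u x : A x ->
  let z := grad_conjugate h u in dot (z - x) (grad hE z - u) <= 0.
Proof.
move=> Ax /=; have [Az cz] := grad_conjugateP u.
set z := grad_conjugate h u in Az cz *.
rewrite -(opprB x z) dotNl oppr_le0 dotBr subr_ge0.
rewrite dot_grad; last exact: hE_diff.
apply: derive_ge => [|s /andP[s0 s1]]; first exact/diff_derivable/hE_diff.
have As : A (z + s *: (x - z)).
  by apply: convex_segment; rewrite ?(ltW s0) ?(ltW s1) // addrC subrK.
have := fenchel_young u As; rewrite cz [dot (z + _) _]dotDl dotZl.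
lra.
Qed.

Definition bregman us u := c u - c us - dot (u - us) (grad_conjugate h us).

(** With z the maximizer at [us], the divergence equals the Fenchel-Young defect c(u) - (<z, u> -
    hE(z)). *)
Lemma bregman_ge0 us u : 0 <= bregman us u.
Proof.
have [Az cz] := grad_conjugateP us.
have := fenchel_young u Az; rewrite /bregman cz dotBl.
rewrite (dotC us) (dotC u); lra.
Qed.

Lemma is_derive_bregman us (u : R -> 'cV[R]_p) (t : R) du :
  is_derive t 1 u du ->
  is_derive t 1 (fun s => bregman us (u s))
    (dot (grad_conjugate h (u t) - grad_conjugate h us) du).
Proof.
move=> hu; have cd := generating_conj_diff hgen (u t).
have -> : dot (grad_conjugate h (u t) - grad_conjugate h us) du =
    'D_du c (u t) - 0 - (dot (du - 0) (grad_conjugate h us) +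
                         dot (u t - us) 0).
  rewrite dotBl dot0r !subr0 addr0 -dot_grad // /grad_conjugate.
  by rewrite [dot du _]dotC [dot du _]dotC.
apply: is_derive_sub; last exact: is_derive_dot.
by apply: is_derive_sub; exact: is_derive_path.
Qed.

End Conjugate.

(** * Separation, and invariance of closed convex sets under averaging *)

Lemma coord_le_dot (R : realType) n (v : 'cV[R]_n) k : `|v k 0| <= 1 + dot v v.
Proof.
have : v k 0 ^+ 2 <= dot v v.
  rewrite dotE (bigD1 k) //= -expr2 lerDl.
  by apply: sumr_ge0 => i _; rewrite -expr2 sqr_ge0.
rewrite ler_norml => h; apply/andP; split; first nra.
nra.
Qed.

(** The separating direction is [x - a] with [a] a nearest point of [A] to [x]; optimality of [a]
    along segments of [A] gives the inequality. *)
Lemma separation (R : realType) n (A : set 'cV[R]_n) x :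
  closed A -> @convex_set R 'cV[R]_n A -> A !=set0 -> ~ A x ->
  exists d (c : R), (forall a, A a -> dot d a <= c) /\ c < dot d x.
Proof.
move=> Acl Acv [a0 Aa0] nAx; pose f a : R := dot (a - x) (a - x).
have df a : differentiable f a.
  by apply: differentiable_dot; apply: differentiableB => //;
    exact: differentiable_cst.
pose M := 1 + f a0 + \sum_k `|x k 0|.
have bnd a : f a <= f a0 -> forall k, `|a k 0| <= M.
  move=> fa k; have := coord_le_dot (a - x) k; rewrite -/(f a) !mxE => h.
  rewrite -(subrK (x k 0) (a k 0)) (le_trans (ler_normD _ _)) // lerD //.
    by apply: le_trans h _; rewrite lerD2l.
  rewrite (bigD1 k) //= lerDl; exact: sumr_ge0.
have [||a [Aa _ amin]] := @box_min R n A f M Acl.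
- by move=> a _; exact: differentiable_continuous.
- by exists a0 => //; exact: bnd.
have {}amin b : A b -> f a <= f b.
  move=> Ab; have [ba0|/ltW] := leP (f b) (f a0).
    by apply: amin => //; exact: bnd.
  by apply: le_trans; apply: amin => //; exact: bnd.
exists (x - a), (dot (x - a) a); split => [b Ab|].
  have : 0 <= 'D_(b - a) f a.
    apply: derive_ge => [|s /andP[s0 s1]]; first exact: diff_derivable.
    rewrite mulr0 subr_ge0; apply: amin; apply: convex_segment => //.
      by rewrite addrC subrK.
    by rewrite !ltW.
  have hd : is_derive a (b - a) (fun c => c - x) (b - a).
    by apply: is_derive_eq; rewrite subr0.
  have [_ ->] := is_derive_dot hd hd.
  rewrite !dotBl !dotBr (dotC b) (dotC x b) (dotC a x); lra.
rewrite -subr_gt0 -dotBr lt_def dot_ge0 andbT; apply/eqP => /dot_eq0/eqP.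
by rewrite subr_eq0 => /eqP xa; apply: nAx; rewrite xa.
Qed.

(** A maximum principle: at a positive maximum the equation forces a negative derivative, so [h] was
    larger just before. No integration across the singularity at 0 is involved. *)
Lemma averaging_path_le0 (R : realType) (r : R) (h k : R -> R) :
  0 < r -> {within `[0, +oo[, continuous h} -> h 0 <= 0 ->
  (forall t, 0 < t -> k t <= 0 /\ is_derive t 1 h (r / t * (k t - h t))) ->
  forall t, 0 <= t -> h t <= 0.
Proof.
move=> r0 ch h0 dh t t0; rewrite leNgt; apply/negP => ht.
have [|s] := @EVT_max R h 0 t t0.
  by apply: continuous_subspaceW ch; apply: subset_itvl.
rewrite in_itv /= => /andP[s0 st] smax.
have hs : 0 < h s.
  by apply: lt_le_trans ht _; apply: smax; rewrite in_itv /= t0 lexx.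
have {}s0 : 0 < s.
  rewrite lt_neqAle s0 andbT; apply/eqP => s0'.
  by move: hs; rewrite -s0' ltNge h0.
have [ks [ds dsE]] := dh s s0.
(* The maximum may sit at the right end [t], so only backward steps are available. The direction
   [- s] is scaled so that steps of size e < 1 end at s (1 - e), inside the interval. *)
have : 'D_(- s) h s <= 0.
  apply: derive_le => [|e /andP[e0 e1]].
    by apply: diff_derivable; apply/derivable1_diffP.
  rewrite mulr0 subr_le0; apply: smax; rewrite in_itv /= /GRing.scale /=.
  by apply/andP; split; nra.
have -> : - s = (- s) *: (1 : R) by rewrite /GRing.scale /= mulr1.
rewrite derive_scale_dir; last exact/derivable1_diffP.
rewrite dsE mulrA -[r / s]mulrC mulrA mulNr mulfV ?gt_eqF // mulN1r.
rewrite mulNr oppr_le0 pmulr_rge0 // subr_ge0 leNgt => /negP; apply.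
exact: le_lt_trans hs.
Qed.

(** If the path were outside [A] at time [t], a hyperplane would separate that point from [A]; the
    scalar maximum principle applied to the corresponding linear form excludes this. *)
Lemma averaging_path_in (R : realType) n (A : set 'cV[R]_n) (r : R)
    (z w : R -> 'cV[R]_n) :
  closed A -> @convex_set R 'cV[R]_n A -> 0 < r ->
  {within `[0, +oo[, continuous z} -> A (z 0) ->
  (forall t, 0 < t -> A (w t) /\ is_derive t 1 z ((r / t) *: (w t - z t))) ->
  forall t, 0 <= t -> A (z t).
Proof.
move=> Acl Acv r0 cz z0 dz t t0; apply: contrapT => nA.
have [d [c [dA dx]]] := separation Acl Acv (ex_intro _ _ z0) nA.
suff : dot d (z t) - c <= 0 by rewrite subr_le0 leNgt dx.
apply: (averaging_path_le0 (h := fun s => dot d (z s) - c)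
  (k := fun s => dot d (w s) - c) r0) => //.
- move=> s; apply: (continuous_comp (g := fun v => dot d v - c)).
    exact: cz.
  apply: continuousB; last exact: cst_continuous.
  exact: (@linear_cV_continuous R R^o n (dot d) (z s)).
- by rewrite subr_le0 dA.
move=> s s0; have [Aw hz] := dz s s0; split; first by rewrite subr_le0 dA.
have := is_derive_sub (is_derive_linear (dot d) hz) (is_derive_const c _ _).
by rewrite /= subr0 dotZr dotBr opprB addrA subrK.
Qed.

(** * Strictly convex functions and convergence of minimizing paths *)

Section StrictConvexity.
Context {R : realType} {n : nat}.
Implicit Types (A : set 'cV[R]_n) (f : 'cV[R]_n -> R) (x z : 'cV[R]_n).

Lemma coord_le_norm (v : 'cV[R]_n) k : `|v k 0| <= `|v|.
Proof.
rewrite [leRHS]/Num.norm /= mx_normrE.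
by apply/bigmax_geP; right; exists (k, 0).
Qed.

Lemma strictly_convex_sub A B f : A `<=` B -> @convex_set R 'cV[R]_n A ->
  strictly_convex_on B f -> strictly_convex_on A f.
Proof. by move=> AB cA [_ sf]; split => // x y t /AB Bx /AB; exact: sf. Qed.

Lemma strictly_convex_segment A f x z (s : R) : strictly_convex_on A f ->
  A x -> A z -> 0 < s < 1 -> f (x + s *: (z - x)) - f x <= s * (f z - f x).
Proof.
move=> [_ sf] Ax Az s01.
have [->|/eqP zx] := eqVneq z x.
  by rewrite !subrr scaler0 addr0 mulr0 subrr.
have -> : x + s *: (z - x) = s *: z + (1 - s) *: x.
  by rewrite scalerBr scalerBl scale1r addrCA.
have := sf z x s Az Ax zx s01; lra.
Qed.

Lemma strictly_convex_derive_le A f x z : strictly_convex_on A f ->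
  A x -> A z -> differentiable f x -> 'D_(z - x) f x <= f z - f x.
Proof.
move=> sf Ax Az df; apply: derive_le => [|s s01]; first exact: diff_derivable.
exact: strictly_convex_segment sf Ax Az s01.
Qed.

Lemma strictly_convex_min_unique A f x z : strictly_convex_on A f ->
  A x -> (forall y, A y -> f x <= f y) -> A z -> z <> x -> f x < f z.
Proof.
move=> [cA sf] Ax xmin Az zx.
have s01 : 0 < (2^-1 : R) < 1 by apply/andP; split; lra.
have Am : A (2^-1 *: z + (1 - 2^-1) *: x).
  have -> : 2^-1 *: z + (1 - 2^-1) *: x = x + 2^-1 *: (z - x).
    by rewrite scalerBr scalerBl scale1r addrCA.
  apply: convex_segment => //; first by rewrite addrC subrK.
  by apply/andP; split; lra.
have := xmin _ Am; have := sf z x _ Az Ax zx s01; lra.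
Qed.

(* On the part of [A] at distance [e] from the minimizer [f] exceeds its
   minimum by some [m > 0], and by convexity also everywhere further away. *)
Lemma strictly_convex_min_cvg A f xs (x : R -> 'cV[R]_n) :
  closed A -> strictly_convex_on A f -> {in A, continuous f} ->
  A xs -> (forall z, A z -> f xs <= f z) ->
  (\forall t \near +oo, A (x t)) -> f (x t) @[t --> +oo] --> f xs ->
  x t @[t --> +oo] --> xs.
Proof.
move=> Acl sf cf Axs xsmin Ax fx; apply/cvgrPdist_lt => e e0.
pose S := A `&` [set z | `|z - xs| = e].
have Scl : closed S.
  apply: closedI => //; apply: (@closed_comp _ _ (fun z => `|z - xs|) [set e]).
    move=> z _; apply: continuous_comp; last exact: norm_continuous.
    by apply: continuousB; [exact: cvg_id|exact: cst_continuous].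
  exact: closed_eq.
have [m m0 mS] : exists2 m, 0 < m & forall z, S z -> m <= f z - f xs.
  have [[z0 Sz0]|S0] := pselect (S !=set0); last first.
    by exists 1 => // z Sz; exfalso; apply: S0; exists z.
  pose M := `|xs| + e.
  have bnd z : S z -> forall k, `|z k 0| <= M.
    move=> [_ /= ze] k; apply: le_trans (coord_le_norm z k) _.
    by rewrite -(subrK xs z) addrC (le_trans (ler_normD _ _)) // ze.
  have [||z [[Az ze] _ zmin]] := @box_min R n S f M Scl.
  - by move=> z /set_mem[Az _]; apply: cf; exact/mem_set.
  - by exists z0 => //; exact: bnd.
  exists (f z - f xs) => [|y Sy].
    rewrite subr_gt0; apply: (strictly_convex_min_unique sf) => // zxs.
    by move: ze e0; rewrite /= zxs subrr normr0 => <-; rewrite ltxx.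
  by rewrite lerD2r; apply: zmin => //; exact: bnd.
have /cvgrPdist_lt/(_ m m0) fxm := fx.
near=> t; have At : A (x t) by near: t.
have : `|f xs - f (x t)| < m by near: t.
rewrite distrC ger0_norm ?subr_ge0; last exact: xsmin.
rewrite ltNge => /negP h; rewrite distrC ltNge; apply/negP => ex.
apply: h; set d := x t - xs in ex *.
have d0 : 0 < `|d| by exact: lt_le_trans ex.
pose s := e / `|d|.
have s0 : 0 < s by rewrite divr_gt0.
have s1 : s <= 1 by rewrite ler_pdivrMr // mul1r.
have dE : xs + d = x t by rewrite addrC subrK.
have Sz : S (xs + s *: d).
  split; first by apply: convex_segment; rewrite ?dE ?(ltW s0) //; case: sf.
  rewrite /= addrC addKr normrZ ger0_norm ?(ltW s0) // /s divfK // gt_eqF //.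
apply: le_trans (mS _ Sz) _.
have [s1'|s1'] := ltP s 1; last first.
  have -> : s = 1 by apply/eqP; rewrite eq_le s1.
  by rewrite scale1r dE.
have s01 : 0 < s < 1 by rewrite s0.
apply: le_trans (strictly_convex_segment sf Axs At s01) _.
by rewrite ler_piMl // subr_ge0 xsmin.
Unshelve. all: by end_near. Qed.

End StrictConvexity.

(** * Products of constraint sets and separable costs *)

Section ProductSet.
Context {R : realType} {n p : nat}.
Variables (A : 'I_n -> set 'cV[R]_p).

Lemma product_set_closed : (forall i, closed (A i)) -> closed (product_set A).
Proof.
move=> Acl; have -> : product_set A = \bigcap_i (block i @^-1` A i).
  by apply/seteqP; split => v /= h i => [_|]; exact: h.
apply: closed_bigI => i _; apply: closed_comp => // v _.
exact: (@linear_cV_continuous R 'cV[R]_p _ (block i) v).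
Qed.

Lemma product_set_convex : (forall i, @convex_set R 'cV[R]_p (A i)) ->
  @convex_set R 'cV[R]_(n * p) (product_set A).
Proof.
move=> cA u v s /set_mem Au /set_mem Av; apply/mem_set => i.
have := cA i (block i u) (block i v) s (mem_set (Au i)) (mem_set (Av i)).
move=> /set_mem.
have -> : conv s (block i u : convex_lmodType 'cV[R]_p) (block i v) =
    s%:num *: block i u + (1 - s%:num) *: block i v by [].
by rewrite -!linearZ -linearD.
Qed.

(** The linear part [b] collects the coupling with the other network and the multiplier term. *)
Definition separable (f : 'I_n -> 'cV[R]_p -> R) (b v : 'cV[R]_(n * p)) : R :=
  \sum_i f i (block i v) + dot b v.

Lemma separable_differentiable f b v :
  (forall i, differentiable (f i) (block i v)) ->
  differentiable (separable f b) v.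
Proof.
move=> df; apply: differentiableD.
  apply: differentiable_bigsum => i.
  apply: (differentiable_comp (f := block i)) => //.
  exact: differentiable_linear.
exact: (differentiable_linear (dot b)).
Qed.

(** Distinct stacked vectors differ in some block, which supplies the strict inequality; the other
    blocks supply weak ones. *)
Lemma separable_strictly_convex f b :
  (forall i, @convex_set R 'cV[R]_p (A i)) ->
  (forall i, strictly_convex_on (A i) (f i)) ->
  strictly_convex_on (product_set A) (separable f b).
Proof.
move=> cA sf; split; first exact: product_set_convex.
move=> u v t Au Av uv t01; rewrite /separable dotDr !dotZr.
have [i uvi] : exists i, block i u <> block i v.
  by apply/existsNP => /block_inj.
have le j : f j (block j (t *: u + (1 - t) *: v)) <=
    t * f j (block j u) + (1 - t) * f j (block j v).
  rewrite linearD !linearZ /=.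
  have [->|/eqP ne] := eqVneq (block j u) (block j v).
    by rewrite -scalerDl -mulrDl addrC subrK scale1r mul1r.
  by apply/ltW; apply: (sf j).2.
have : \sum_j f j (block j (t *: u + (1 - t) *: v)) <
    t * \sum_j f j (block j u) + (1 - t) * \sum_j f j (block j v).
  rewrite !mulr_sumr -big_split /= (bigD1 i) //= [ltRHS](bigD1 i) //=.
  apply: ltr_leD; last by apply: ler_sum => j _; exact: le.
  by rewrite linearD !linearZ /=; apply: (sf i).2.
lra.
Qed.

End ProductSet.

(** * Laplacians and positive semidefinite forms *)

Section LaplacianKronecker.
Context {R : realType} {n p : nat}.
Variables (A : 'M[R]_n).
Hypotheses (A_sym : A^T = A) (A_ge0 : forall i j, 0 <= A i j).
Let L : 'M[R]_(n * p) := laplacian A *t (1%:M : 'M[R]_p).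

Let AC i j : A i j = A j i. Proof. by rewrite -{1}A_sym mxE. Qed.

Lemma laplacian_tens_sym : L^T = L.
Proof.
have lapC : (laplacian A)^T = laplacian A.
  by rewrite /laplacian linearB /= tr_diag_mx A_sym.
by rewrite /L trmx_tens lapC trmx1.
Qed.

Lemma block_laplacian v i :
  block i (L *m v) = \sum_j A i j *: (block i v - block j v).
Proof.
rewrite /L block_tensmx1.
under [RHS]eq_bigr do rewrite scalerBr.
rewrite sumrB -scaler_suml; set d := \sum_j A i j.
have lapE j : laplacian A i j *: block j v =
    (if j == i then d *: block j v else 0) - A i j *: block j v.
  by rewrite !mxE scalerBl eq_sym; case: eqP => _ //; rewrite mulr0n scale0r.
under eq_bigr do rewrite lapE.
by rewrite sumrB -big_mkcond big_pred1_eq.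
Qed.

Lemma laplacian_consensus v :
  (forall i j, block i v = block j v) -> L *m v = 0.
Proof.
move=> cv; apply: block_inj => i; rewrite block_laplacian linear0.
by rewrite big1 // => j _; rewrite (cv i j) subrr scaler0.
Qed.

(** Adding the double sum to itself with the indices exchanged turns it into the sum of A_ij |v_i -
    v_j|^2. *)
Lemma laplacian_psd v : 0 <= dot v (L *m v).
Proof.
have E : dot v (L *m v) =
    \sum_i \sum_j A i j * dot (block i v) (block i v - block j v).
  rewrite dot_block; apply: eq_bigr => i _; rewrite block_laplacian dot_sumr.
  by apply: eq_bigr => j _; rewrite dotZr.
suff : 0 <= dot v (L *m v) + dot v (L *m v) by lra.
rewrite {1}E exchange_big /= E -big_split sumr_ge0 // => i _.
rewrite -big_split sumr_ge0 // => j _ /=; rewrite (AC j i) -mulrDr mulr_ge0 //.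
by rewrite -opprB dotNr addrC -dotBl dot_ge0.
Qed.

End LaplacianKronecker.

Section PositiveSemidefinite.
Context {R : realType} {n : nat}.
Variables (L : 'M[R]_n).

Lemma quad_form_bound : exists2 M : R, 0 < M &
  forall v : 'cV_n, dot v (L *m v) <= M * dot v v.
Proof.
exists (1 + \sum_i \sum_j `|L i j|) => [|v].
  by rewrite ltr_wpDr // sumr_ge0 // => i _; rewrite sumr_ge0.
have coord (k : 'I_n) : v k 0 ^+ 2 <= dot v v.
  rewrite dotE (bigD1 k) //= -expr2 lerDl.
  by apply: sumr_ge0 => i _; rewrite -expr2 sqr_ge0.
rewrite mulrDl mul1r ler_wpDl ?dot_ge0 // {1}dotE mulr_suml.
apply: ler_sum => i _; rewrite mxE mulr_sumr mulr_suml; apply: ler_sum => j _.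
have := coord i; have := coord j; move: (dot v v) => S hj hi.
have h : `|v i 0 * v j 0| <= S.
  by rewrite ler_norml; apply/andP; split; nra.
rewrite mulrCA; apply: le_trans (ler_norm _) _.
by rewrite normrM ler_wpM2l.
Qed.

Hypotheses (L_sym : L^T = L) (L_psd : forall v, 0 <= dot v (L *m v)).

Lemma dot_symC (u v : 'cV_n) : dot u (L *m v) = dot v (L *m u).
Proof. by rewrite dot_mulmx L_sym dotC. Qed.

(** Nonnegativity of the form at the gradient step v - L v / M, with M a bound of the form, leaves
    exactly this inequality. *)
Lemma psd_image_bound : exists2 M : R, 0 < M &
  forall v : 'cV_n, dot (L *m v) (L *m v) <= M * dot v (L *m v).
Proof.
have [M M0 LM] := quad_form_bound; exists M => // v.
set w := L *m v; have := L_psd (v - M^-1 *: w).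
rewrite mulmxBr -scalemxAr -/w dotBl !dotBr !dotZl !dotZr.
rewrite (dot_symC v w) -/w => h.
have h2 : M^-1 * (M^-1 * dot w (L *m w)) <= M^-1 * dot w w.
  by rewrite ler_pM2l ?invr_gt0 // ler_pdivrMl // LM.
rewrite -ler_pdivrMl //; lra.
Qed.

(** If F(z) < F(xs), then towards [z] the function F drops at least linearly in the step, while the
    quadratic term, which vanishes to second order at [xs], grows only with its square. *)
Lemma min_drop_quadratic (A : set 'cV[R]_n) (F : 'cV[R]_n -> R) xs :
  strictly_convex_on A F -> A xs -> L *m xs = 0 ->
  (forall z, A z -> F xs <= F z + 2^-1 * dot z (L *m z)) ->
  forall z, A z -> F xs <= F z.
Proof.
move=> sf Axs Lxs h z Az; rewrite leNgt; apply/negP => zlt.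
set Q := dot z (L *m z) in h *; have Q0 : 0 <= Q by exact: L_psd.
pose d := F xs - F z; have d0 : 0 < d by rewrite subr_gt0.
(* This step gives s Q <= d / 2, against the d <= s Q that minimality yields; adding [d] keeps the
   denominator positive when Q = 0. *)
pose s := d / (2 * (Q + d)).
have den : 0 < 2 * (Q + d) by lra.
have s0 : 0 < s by rewrite divr_gt0.
have sE : s * (2 * (Q + d)) = d by rewrite divfK // gt_eqF.
have s1 : s < 1 by rewrite ltr_pdivrMr // mul1r; lra.
have s01 : 0 < s < 1 by rewrite s0 s1.
have As : A (xs + s *: (z - xs)).
  apply: convex_segment; [by case: sf|by []| |by rewrite !ltW].
  by rewrite addrC subrK.
have := h _ As; have := strictly_convex_segment sf Axs Az s01.
rewrite mulmxDr -scalemxAr mulmxBr Lxs subr0 add0r dotDl !dotZl !dotZr dotBl.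
rewrite !(dot_symC xs) Lxs !dot0r -/Q.
have dE : F z - F xs = - d by rewrite /d opprB.
rewrite dE => h1 h2; have : 0 <= s * (s * Q).
  by apply: mulr_ge0; [exact: ltW|apply: mulr_ge0 => //; exact: ltW].
move=> h3; have : d <= s * Q by rewrite -(ler_pM2l s0); lra.
nra.
Qed.

End PositiveSemidefinite.

(** A coarse Cauchy-Schwarz inequality, sufficient because [u] will be the fixed multiplier and only
    the rate in [v] matters. *)
Lemma dot_le_enorm (R : realType) n (u v : 'cV[R]_n) :
  `|dot u v| <= (\sum_k `|u k 0|) * enorm v.
Proof.
rewrite dotE mulr_suml (le_trans (ler_norm_sum _ _ _)) // ler_sum // => k _.
rewrite normrM ler_wpM2l // -sqrtr_sqr ler_wsqrtr // dotE (bigD1 k) //= -expr2.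
by rewrite lerDl sumr_ge0 // => i _; rewrite -expr2 sqr_ge0.
Qed.

(** Up to an additive constant this is [S2] as a function of [x], and minus [S2] as a function of
    [y]. *)
Definition regularized (R : realType) n p (f : 'I_n -> 'cV[R]_p -> R)
    (L : 'M[R]_(n * p)) (b v : 'cV[R]_(n * p)) : R :=
  separable f b v + 2^-1 * dot v (L *m v).

Lemma regularized_differentiable (R : realType) n p
    (f : 'I_n -> 'cV[R]_p -> R) (L : 'M[R]_(n * p)) c z :
  (forall i, differentiable (f i) (block i z)) ->
  differentiable (regularized f L c) z.
Proof.
move=> df; apply: differentiableD; first exact: separable_differentiable.
apply: differentiableZ; apply: differentiable_dot => //.
exact: (differentiable_linear (mulmx L)).
Qed.

(* One of the two networks. The other one enters only through the force [a],
   the gradient of the coupling term, and its limit value [a_]. *)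
Record player (R : realType) (n p : nat) (X : 'I_n -> set 'cV[R]_p)
    (f : 'I_n -> 'cV[R]_p -> R) (L : 'M[R]_(n * p))
    (h : 'I_n -> 'cV[R]_p -> \bar R) (hE : 'I_n -> 'cV[R]_p -> R) (r : R)
    (x u ta a x' : R -> 'cV[R]_(n * p)) (xs us ls a_ : 'cV[R]_(n * p)) : Prop :=
  Player {
  player_closed : forall i, closed (X i);
  player_convex : forall i, @convex_set R 'cV[R]_p (X i);
  player_strict : forall i, strictly_convex_on (X i) (f i);
  player_diff : forall i z, X i z -> differentiable (f i) z;
  player_sym : L^T = L;
  player_psd : forall v, 0 <= dot v (L *m v);
  player_gen : forall i, generating (X i) (h i) (hE i);
  player_r : 2 <= r;
  player_mirror : forall t i,
    block i (x' t) = grad_conjugate (h i) (block i (u t));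
  player_cont : {within `[0, +oo[, continuous x};
  player_init : x 0 = x' 0;
  player_dx : forall t : R, 0 < t -> is_derive t 1 x ((r / t) *: (x' t - x t));
  player_du : forall t : R, 0 < t -> product_set X (x t) ->
    exists2 du, is_derive t 1 u du & forall i, block i du = (t / r) *:
      (- block i (grad (regularized f L (a t + L *m ta t)) (x t))
       + grad (hE i) (block i (x' t)) - block i (u t));
  player_dta : forall t : R, 0 < t -> is_derive t 1 ta ((t / r) *: (L *m x' t));
  player_eq : forall i, block i xs = grad_conjugate (h i) (block i us);
  player_consensus : L *m xs = 0;
  player_feasible : product_set X xs;
  player_min : forall z, product_set X z ->
    regularized f L (a_ + L *m ls) xs <= regularized f L (a_ + L *m ls) z
}.

(** * A single player: decay of its share of V, and the resulting rates *)

Section Player.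
Context {R : realType} {n p : nat} {X : 'I_n -> set 'cV[R]_p}.
Context {f : 'I_n -> 'cV[R]_p -> R} {L : 'M[R]_(n * p)}.
Context {h : 'I_n -> 'cV[R]_p -> \bar R} {hE : 'I_n -> 'cV[R]_p -> R} {r : R}.
Context {x u ta a x' : R -> 'cV[R]_(n * p)} {xs us ls a_ : 'cV[R]_(n * p)}.
Hypothesis P : player X f L h hE r x u ta a x' xs us ls a_.

Let b := a_ + L *m ls.
Let D := product_set X.
Let sep_sc c : strictly_convex_on D (separable f c).
Proof.
exact: separable_strictly_convex (player_convex P) (player_strict P).
Qed.

Let sep_diff c z : D z -> differentiable (separable f c) z.
Proof.
move=> Dz; apply: separable_differentiable => i.
exact: (player_diff P (Dz i)).
Qed.

Let Dcl : closed D. Proof. exact: product_set_closed (player_closed P). Qed.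

Let r0 : 0 < r. Proof. by apply: lt_le_trans (player_r P). Qed.

Let reg_diff c z : D z -> differentiable (regularized f L c) z.
Proof.
move=> Dz; apply: regularized_differentiable => i.
exact: (player_diff P (Dz i)).
Qed.

(** The dependence on [c] is made explicit, so that the derivatives for the limit force and for the
    current force share the term of [separable f 0]. *)
Lemma is_derive_regularized c z w : D z ->
  is_derive z w (regularized f L c)
    ('D_w (separable f 0) z + dot c w + dot w (L *m z)).
Proof.
move=> Dz.
have hs : is_derive z w (separable f 0) ('D_w (separable f 0) z).
  exact/derivableP/diff_derivable/sep_diff.
have hl (d : 'cV[R]_(n * p)) : is_derive z w (dot d) (dot d w).
  exact: (is_derive_linear (dot d) (is_derive_id z w)).
have hL := is_derive_linear (mulmx L) (is_derive_id z w).
have hq := is_derive_scale 2^-1 (is_derive_dot (is_derive_id z w) hL).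
have hc := is_derive_add hs (hl c).
have := is_derive_add hc hq.
rewrite /= (dot_symC (player_sym P) z) => hd.
suff -> : regularized f L c = fun q => separable f 0 q + dot c q +
    2^-1 * dot q (L *m q) by apply: (is_derive_eq hd); lra.
by apply/funext => q; rewrite /regularized /separable dot0l addr0.
Qed.

Lemma player_mirror_in t : D (x' t).
Proof.
move=> i; rewrite (player_mirror P).
exact: (grad_conjugateP (player_gen P i) (player_closed P (i:=i)) _).1.
Qed.

Lemma player_path_in t : 0 <= t -> D (x t).
Proof.
apply: (averaging_path_in (w := x') Dcl _ r0 (player_cont P)) => [||s s0].
- exact: product_set_convex (player_convex P).
- by rewrite (player_init P); exact: player_mirror_in.
- by split; [exact: player_mirror_in|exact (player_dx P s0)].
Qed.

Definition excess (t : R) : R :=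
  regularized f L b (x t) - regularized f L b xs.

Lemma excess_ge0 t : 0 <= t -> 0 <= excess t.
Proof.
by move=> t0; rewrite subr_ge0; apply: player_min P _ (player_path_in t0).
Qed.

Definition lyapunov (t : R) : R := (t / r) ^+ 2 * excess t +
  \sum_i bregman (h i) (block i us) (block i (u t)) +
  2^-1 * dot (ta t - ls) (ta t - ls).

Lemma excess_le_lyapunov t : (t / r) ^+ 2 * excess t <= lyapunov t.
Proof.
rewrite /lyapunov -addrA lerDl addr_ge0 //.
  apply: sumr_ge0 => i _.
  exact: (bregman_ge0 (player_gen P i) (player_closed P (i:=i))).
by rewrite mulr_ge0 ?dot_ge0 // invr_ge0.
Qed.

(* The remaining term is the work of the force of the other network; it cancels
   against the same term of the other player. *)
Lemma lyapunov_derive (t : R) : 0 < t -> exists2 dV, is_derive t 1 lyapunov dV &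
  dV <= - (t / r) * dot (x' t - xs) (a t - a_).
Proof.
move=> t0; have Dx := player_path_in (ltW t0).
have [du hu duE] := player_du P t0 Dx.
have hx := player_dx P t0; have hta := player_dta P t0.
set dx := (r / t) *: _ in hx.
pose c := a t + L *m ta t.
have hexc : is_derive t 1 excess ('D_dx (regularized f L b) (x t)).
  have h1 := is_derive_path (reg_diff b Dx) hx.
  have := is_derive_sub h1 (is_derive_const (regularized f L b xs) t 1).
  by rewrite subr0.
have htr : is_derive t 1 (fun s => (s / r) ^+ 2) (2 * (t / r) / r).
  have h1 : is_derive t 1 (fun s : R => s * r^-1) r^-1.
    have := is_derive_mul (is_derive_id t (1 : R)) (is_derive_const r^-1 t 1).
    by rewrite /= mulr0 addr0 mul1r.
  by apply: (is_derive_eq (is_derive_mul h1 h1)); lra.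
have hbr : is_derive t 1
    (fun s => \sum_i bregman (h i) (block i us) (block i (u s)))
    (\sum_i dot (block i (x' t) - block i xs) (block i du)).
  apply: is_derive_bigsum => i; rewrite (player_mirror P) (player_eq P).
  apply: (is_derive_bregman (player_gen P i)).
  exact: (is_derive_linear (block i) hu).
have hq : is_derive t 1 (fun s => 2^-1 * dot (ta s - ls) (ta s - ls))
    ((t / r) * dot (ta t - ls) (L *m x' t)).
  have h1 : is_derive t 1 (fun s => ta s - ls) ((t / r) *: (L *m x' t)).
    by apply: is_derive_eq; rewrite subr0.
  apply: (is_derive_eq (is_derive_scale 2^-1 (is_derive_dot h1 h1))).
  rewrite dotC dotZr; lra.
eexists.
  exact: (is_derive_add (is_derive_add (is_derive_mul htr hexc) hbr) hq).
have tr0 : 0 < t / r by rewrite divr_gt0.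
(* The part grad hE(x') - u of the velocity of [u] contributes a nonpositive amount, by the
   variational inequality for x' tested at the feasible point [xs]. *)
have brle : \sum_i dot (block i (x' t) - block i xs) (block i du) <=
    - (t / r) * 'D_(x' t - xs) (regularized f L c) (x t).
  rewrite -dot_grad; last exact: reg_diff.
  rewrite dot_block mulr_sumr; apply: ler_sum => i _.
  rewrite duE dotZr mulNr -mulrN ler_pM2l // -addrA dotDr dotNr -linearB /=.
  rewrite gerDl [block i _](linearB (block i)) /= (player_mirror P).
  exact: (grad_conjugate_variational (player_gen P i) (player_closed P (i:=i))
    (player_convex P (i:=i)) _ (player_feasible P i)).
have trK : t / r * (r / t) = 1.
  by rewrite mulf_div [r * t]mulrC divff // mulf_neq0 // gt_eqF.
have dxE : (t / r) ^+ 2 * 'D_dx (regularized f L b) (x t) =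
    (t / r) * 'D_(x' t - x t) (regularized f L b) (x t).
  rewrite derive_scale_dir; last exact: reg_diff.
  by rewrite expr2 -mulrA [X in _ * X]mulrA trK mul1r.
rewrite dxE.
have Dreg w d : 'D_w (regularized f L d) (x t) = _ :=
  @derive_val _ _ _ _ _ _ _ (is_derive_regularized d w Dx).
move: brle; rewrite !Dreg.
have Fle := strictly_convex_derive_le (sep_sc 0) Dx (player_feasible P)
  (sep_diff 0 Dx).
have FE : 'D_(xs - x t) (separable f 0) (x t) =
    'D_(x' t - x t) (separable f 0) (x t)
    - 'D_(x' t - xs) (separable f 0) (x t).
  rewrite !deriveE; try exact: sep_diff.
  by rewrite -linearB opprB [x' t - _ + _]addrC addrA subrK.
have e0 := excess_ge0 (ltW t0).
have eE : excess t = separable f 0 (x t) + dot b (x t)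
    + 2^-1 * dot (x t) (L *m x t) - separable f 0 xs - dot b xs.
  rewrite /excess /regularized /separable !dot0l (player_consensus P) dot0r.
  move: (\sum_i _) (\sum_i _) (dot b _) (dot b _) (2^-1 * _).
  clear -P b sep_sc sep_diff Dcl r0 reg_diff => *; lra.
(* The derivative of (t/r)^2 is (t/r)(2/r), so the excess enters with a factor at most t/r. *)
have r1 : 2 / r <= 1 by rewrite (ler_pdivrMr _ _ r0) mul1r; exact: player_r P.
have er : 2 / r * excess t <= excess t := ler_piMl e0 r1.
set S := \sum_i _ => Sle.
pose T := t / r.
have T0 : 0 < T by [].
have sym w v : dot (L *m w) v = dot w (L *m v).
  by rewrite dot_mulmx (player_sym P).
have xsL v : dot xs (L *m v) = 0 by rewrite -sym (player_consensus P) dot0l.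
(* The bound on the derivative divided by t/r, with the work term moved to the left. All linear
   terms cancel; the tangent inequality for the strictly convex part leaves at most - <x, L x> /
   2. *)
have key : excess t
    + ('D_(x' t - x t) (separable f 0) (x t) + dot b (x' t - x t)
       + dot (x' t - x t) (L *m x t))
    - ('D_(x' t - xs) (separable f 0) (x t) + dot c (x' t - xs)
       + dot (x' t - xs) (L *m x t))
    + dot (ta t - ls) (L *m x' t) + dot (x' t - xs) (a t - a_) <= 0.
  have := player_psd P (x t).
  move: Fle; rewrite FE eE.
  set F1 := 'D_(x' t - x t) _ _; set F2 := 'D_(x' t - xs) _ _.
  clearbody F1 F2; rewrite /separable !dot0l (dotC _ (a t - a_)) /b /c.
  rewrite !(dotBl, dotBr, dotDl, dotDr) !sym (player_consensus P) !dot0r !xsL.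
  move: (\sum_i _) (\sum_i _) => s1 s2.
  move: (dot a_ xs) (dot a_ (x t)) (dot a_ (x' t)) => y1 y2 y3.
  move: (dot (a t) xs) (dot (a t) (x' t)) => y4 y5.
  move: (dot ls (L *m x t)) (dot ls (L *m x' t)) => y6 y7.
  move: (dot (ta t) _) (dot (x t) _) (dot (x' t) _) => y8 y9 y10.
  move: F1 F2 s1 s2 y1 y2 y3 y4 y5 y6 y7 y8 y9 y10.
  clear -P b sep_sc sep_diff Dcl r0 reg_diff => *; lra.
have k2 := key; rewrite -(pmulr_rle0 _ T0) in k2.
have : T * (2 / r * excess t) <= T * excess t by rewrite ler_pM2l.
rewrite -/T in Sle *.
have assoc (w ri e : R) : 2 * w * ri * e = w * (2 * ri * e) by ring.
rewrite assoc; clearbody T S.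
move: k2 Sle.
set A := 'D_(x' t - x t) _ _ + _ + _; set A' := 'D_(x' t - xs) _ _ + _ + _.
set w := dot (ta t - ls) _; set z := dot (x' t - xs) (a t - a_).
set k := 2 / r * _; set g := excess t; clearbody A A' w z k g.
move: S A A' w z k g; clear -P b sep_sc sep_diff Dcl r0 reg_diff => *; lra.
Qed.

Lemma separable_min z : D z -> separable f b xs <= separable f b z.
Proof.
apply: (min_drop_quadratic (player_sym P) (player_psd P) (sep_sc b)
  (player_feasible P) (player_consensus P)) => y Dy.
have := player_min P Dy.
by rewrite {1}/regularized (player_consensus P) dot0r mulr0 addr0.
Qed.

Lemma player_rate (C : R) :
  (forall t, 1 <= t -> (t / r) ^+ 2 * excess t <= C) ->
  [/\ x t @[t --> +oo] --> xs,
      exists K, forall t, 1 <= t -> enorm (L *m x t) <= K / t &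
      exists K, forall t, 1 <= t ->
        `|separable f b (x t) - separable f b xs| + `|dot ls (L *m x t)|
          <= K / t].
Proof.
move=> hC; pose K := C * r ^+ 2.
have t0 t : 1 <= t -> 0 < t :> R by apply: lt_le_trans.
have sum_le t : 1 <= t -> separable f b (x t) - separable f b xs
    + 2^-1 * dot (x t) (L *m x t) <= K / t ^+ 2.
  move=> t1; rewrite ler_pdivlMr ?exprn_gt0 ?t0 //.
  have := hC t t1; rewrite expr_div_n mulrAC ler_pdivrMr ?exprn_gt0 //.
  rewrite /excess /regularized (player_consensus P) dot0r -/K; lra.
clearbody K.
have sep_ge0 t : 1 <= t -> 0 <= separable f b (x t) - separable f b xs.
  by move=> t1; rewrite subr_ge0; apply/separable_min/player_path_in/ltW/t0.
have K0 : 0 <= K.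
  have := sum_le 1 (lexx _); have := sep_ge0 1 (lexx _).
  have := player_psd P (x 1); rewrite expr1n divr1; lra.
(* The cost difference is weakened to 1/t because it is added to the multiplier term, for which only
   1/t is available. *)
have inv2 t : 1 <= t -> K / t ^+ 2 <= K / t.
  move=> t1; rewrite ler_wpM2l // lef_pV2 ?posrE ?exprn_gt0 ?t0 //.
  by rewrite expr2 ler_peMl // ltW // t0.
have sep_le t : 1 <= t ->
    `|separable f b (x t) - separable f b xs| <= K / t.
  move=> t1; rewrite ger0_norm ?sep_ge0 // (le_trans _ (inv2 t t1)) //.
  have := sum_le t t1; have := player_psd P (x t); lra.
have [M M0 LM] := psd_image_bound (player_sym P) (player_psd P).
(* From |L x|^2 <= M <x, L x> and <x, L x> / 2 <= K / t^2. *)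
pose N := Num.sqrt (M * (2 * K)).
have Lx_le t : 1 <= t -> enorm (L *m x t) <= N / t.
  move=> t1; have -> : N / t = Num.sqrt (M * (2 * K) / t ^+ 2).
    have MK0 : 0 <= M * (2 * K).
      by apply: mulr_ge0; [exact: ltW|exact: mulr_ge0].
    rewrite sqrtrM // -exprVn sqrtr_sqr ger0_norm // invr_ge0.
    exact/ltW/t0.
  apply: ler_wsqrtr; apply: le_trans (LM _) _; rewrite -!mulrA ler_pM2l //.
  have := sum_le t t1; have := sep_ge0 t t1; lra.
split.
- apply: (strictly_convex_min_cvg Dcl (sep_sc b)) => [z /set_mem Dz||||].
  + by apply: differentiable_continuous; exact: sep_diff.
  + exact: player_feasible P.
  + exact: separable_min.
  + by near=> t; apply: player_path_in; near: t; exact: nbhs_pinfty_ge.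
  + apply/cvgrPdist_lt => e e0; near=> t.
    have t1 : 1 <= t by near: t; exact: nbhs_pinfty_ge.
    rewrite distrC; apply: le_lt_trans (sep_le t t1) _.
    rewrite ltr_pdivrMr ?t0 // mulrC -ltr_pdivrMr //.
    by near: t; apply: nbhs_pinfty_gt; exact: num_real.
- by exists N.
exists (K + (\sum_k `|ls k 0|) * N) => t t1; rewrite mulrDl lerD ?sep_le //.
apply: le_trans (dot_le_enorm _ _) _; rewrite -mulrA ler_wpM2l ?Lx_le //.
by apply: sumr_ge0.
Unshelve. all: by end_near. Qed.

End Player.

(** * The game in matrix form and the partial gradients of [S2] *)

Section GradientRules.
Context {R : realType} {n : nat}.
Implicit Types (f : 'cV[R]_n -> R) (x w : 'cV[R]_n).

Lemma grad_addc f (c : R) x : grad (fun a => f a + c) x = grad f x.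
Proof.
apply/colP => k; rewrite !mxE /derive.
by under eq_fun do rewrite /= opprD addrACA subrr addr0.
Qed.

Lemma grad_opp f x : differentiable f x -> grad (fun a => - f a) x = - grad f x.
Proof.
move=> df; apply/colP => k; rewrite !mxE.
exact: deriveN (diff_derivable df).
Qed.

Lemma grad_dotl w x : grad (fun a => dot a w) x = w.
Proof.
apply/colP => k; rewrite !mxE; under eq_fun do rewrite dotC.
rewrite -[RHS]dot_delta.
exact: (@derive_val _ _ _ _ _ _ _
  (is_derive_linear (dot w) (is_derive_id x _))).
Qed.

End GradientRules.

Section BilinearGame.
Context {R : realType} {n1 n2 p q : nat}.
Variable G : game R n1 n2 p q.
Implicit Types (x l : 'cV[R]_(n1 * p)) (y m : 'cV[R]_(n2 * q)).

(** The matrix B of the payoff, with blocks H_ij. *)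
Definition coupling_mx : 'M[R]_(n1 * p, n2 * q) :=
  \matrix_(a, b) coupling G (mxtens_unindex a).1 (mxtens_unindex b).1
    (mxtens_unindex a).2 (mxtens_unindex b).2.

Lemma payoffE x y : payoff G x y = \sum_i costf G i (block i x)
  + dot x (coupling_mx *m y) - \sum_j costg G j (block j y).
Proof.
rewrite /payoff dot_block; congr (_ + _ - _); apply: eq_bigr => i _.
rewrite -dot_sumr; congr dot; apply/colP => k; rewrite summxE !mxE.
rewrite sum_mxtens_index; apply: eq_bigr => j _; rewrite mxE.
by apply: eq_bigr => s _; rewrite !mxE !mxtens_indexK.
Qed.

Lemma S2_regularized_x l y m : (fun x => S2 G x l y m) =
  (fun x => regularized (costf G) (L1 G) (coupling_mx *m y + (L1 G)^T *m l) x
    + (- (\sum_j costg G j (block j y)) - dot m (L2 G *m y)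
       - 2^-1 * dot y (L2 G *m y))).
Proof.
apply/funext => x; rewrite /S2 payoffE /regularized /separable.
rewrite dotDl (dotC (_ *m y)) -dot_mulmx; lra.
Qed.

(** The second player maximizes, so its cost is minus [S2] and the coupling force changes sign. *)
Lemma S2_regularized_y x l m : (fun y => S2 G x l y m) =
  (fun y => - regularized (costg G) (L2 G)
      (- (coupling_mx^T *m x) + (L2 G)^T *m m) y
    + (\sum_i costf G i (block i x) + dot l (L1 G *m x)
       + 2^-1 * dot x (L1 G *m x))).
Proof.
apply/funext => y; rewrite /S2 payoffE /regularized /separable.
rewrite dotDl dotNl -!dot_mulmx; lra.
Qed.

Lemma grad_S2_l x l y m : grad (fun a => S2 G x a y m) l = L1 G *m x.
Proof.
have -> : (fun a => S2 G x a y m) =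
    (fun a => dot a (L1 G *m x) + (S2 G x 0 y m)).
  by apply/funext => a; rewrite /S2 dot0l; lra.
by rewrite grad_addc grad_dotl.
Qed.

Lemma grad_S2_m x l y m : grad (fun a => S2 G x l y a) m = - (L2 G *m y).
Proof.
have -> : (fun a => S2 G x l y a) =
    (fun a => dot a (- (L2 G *m y)) + (S2 G x l y 0)).
  by apply/funext => a; rewrite /S2 dot0l dotNr; lra.
by rewrite grad_addc grad_dotl.
Qed.

End BilinearGame.

Lemma adjacency_ge0 (R : realType) n (e : rel 'I_n) (A : 'M[R]_n) i j :
  connected_weighted_graph e A -> 0 <= A i j.
Proof.
move=> hA; have [eij|neij] := boolP (e i j).
  exact/ltW/(adjacency_edge hA).
by rewrite (adjacency_nonedge hA).
Qed.

Lemma is_derive_derive1 (R : realType) n (z : R -> 'cV[R]_n) (t : R) :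
  derivable z t 1 -> is_derive t 1 z (derive1 z t).
Proof. by move=> hz; rewrite derive1E; exact: derivableP. Qed.

Lemma nonincreasing_after (R : realType) (V : R -> R) :
  (forall t : R, 0 < t -> exists2 dV, is_derive t 1 V dV & dV <= 0) ->
  forall t, 1 <= t -> V t <= V 1.
Proof.
move=> h t t1.
have pos s : 1 <= s -> 0 < s :> R by apply: lt_le_trans.
have dV s : 0 < s -> derivable V s 1 by move=> /h[d []].
apply: (@ler0_derive1_nincry R V 1) => // [s|s|].
- by rewrite in_itv /= andbT => /ltW /pos /dV.
- rewrite in_itv /= andbT => /ltW /pos /h[d [_ dE] d0].
  by rewrite derive1E dE.
apply: continuous_in_subspaceT => s /set_mem /=.
rewrite in_itv /= andbT => /pos s0.
exact/differentiable_continuous/derivable1_diffP/dV.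
Qed.

(** * Both networks along a trajectory *)

Section Trajectory.
Context {R : realType} {n1 n2 p q : nat}.
Context {G : game R n1 n2 p q} {K : generators R n1 n2 p q} {r : R}.
Context {x u l ta : R -> 'cV[R]_(n1 * p)} {y v m nu : R -> 'cV[R]_(n2 * q)}.
Context {xs us ls tas : 'cV[R]_(n1 * p)} {ys vs ms nus : 'cV[R]_(n2 * q)}.
Hypotheses (hr : 2 <= r) (hG : is_game G) (hD : assumptionD G)
  (hK : is_generators G K) (htraj : trajectory G K r x u l ta y v m nu)
  (heq : equilibrium_point G K xs us ls tas ys vs ms nus)
  (hsaddle : saddle_point G xs ls ys ms) (hnash : nash_equilibrium G xs ys).

Let B := coupling_mx G.

(** The extrapolated point x' in a form free of derivatives, meaningful for every [t]. *)
Definition mirror1 t :=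
  stack (fun i => grad_conjugate (psi K i) (block i (u t))).
Definition mirror2 t :=
  stack (fun j => grad_conjugate (phi K j) (block j (v t))).

Let L1_sym : (L1 G)^T = L1 G.
Proof.
by case: hG => [h _ _ _]; apply: laplacian_tens_sym (adjacency_symmetric h).
Qed.

Let L2_sym : (L2 G)^T = L2 G.
Proof.
by case: hG => [_ h _ _]; apply: laplacian_tens_sym (adjacency_symmetric h).
Qed.

Let L1_psd w : 0 <= dot w (L1 G *m w).
Proof.
case: hG => [h _ _ _]; apply: laplacian_psd (adjacency_symmetric h) _ _ => i j.
exact: adjacency_ge0 h.
Qed.

Let L2_psd w : 0 <= dot w (L2 G *m w).
Proof.
case: hG => [_ h _ _]; apply: laplacian_psd (adjacency_symmetric h) _ _ => i j.
exact: adjacency_ge0 h.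
Qed.

Let L1xs : L1 G *m xs = 0.
Proof. by case: hnash => [[_ h] _ _]; exact: laplacian_consensus. Qed.

Let L2ys : L2 G *m ys = 0.
Proof. by case: hnash => [_ [_ h] _]; exact: laplacian_consensus. Qed.

Let L1_dotC w z : dot (L1 G *m w) z = dot w (L1 G *m z).
Proof. by rewrite dot_mulmx L1_sym. Qed.

Let L2_dotC w z : dot (L2 G *m w) z = dot w (L2 G *m z).
Proof. by rewrite dot_mulmx L2_sym. Qed.

Let cancel_rt (t : R) N (w : 'cV[R]_N) : 0 < t -> (t / r) *: ((r / t) *: w) = w.
Proof.
move=> t0; have r0 : 0 < r by apply: lt_le_trans hr.
by rewrite scalerA mulf_div [r * t]mulrC divff ?scale1r // mulf_neq0 // gt_eqF.
Qed.

(** The averaging equations are solved for the extrapolated points. This removes all derivatives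
    from the right-hand sides of the other equations and identifies [ta] and [nu] as the
    extrapolated multipliers. *)
Let extrapolated t : 0 < t ->
  [/\ x t + (t / r) *: derive1 x t = mirror1 t,
      l t + (t / r) *: derive1 l t = ta t,
      y t + (t / r) *: derive1 y t = mirror2 t &
      m t + (t / r) *: derive1 m t = nu t].
Proof.
move=> t0; have [h1 h2] := trajectory_ode htraj t0.
split; apply: block_inj => i; rewrite linearD linearZ /=.
- have [-> _ _ _] := h1 i; rewrite cancel_rt // block_stack /bracket_x addrC.
  by rewrite subrK.
- by have [_ -> _ _] := h1 i; rewrite cancel_rt // /bracket_l addrC subrK.
- have [-> _ _ _] := h2 i; rewrite cancel_rt // block_stack /bracket_y addrC.
  by rewrite subrK.
by have [_ -> _ _] := h2 i; rewrite cancel_rt // /bracket_m addrC subrK.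
Qed.

Let deriv1 (t : R) : 0 < t ->
  [/\ is_derive t 1 x (derive1 x t), is_derive t 1 u (derive1 u t) &
      is_derive t 1 ta (derive1 ta t)].
Proof.
by case: (trajectory_regular1 htraj) => [[_ hx] [_ hu] _ [_ hta]] t0;
  split; apply: is_derive_derive1; [exact: hx|exact: hu|exact: hta].
Qed.

Let deriv2 (t : R) : 0 < t ->
  [/\ is_derive t 1 y (derive1 y t), is_derive t 1 v (derive1 v t) &
      is_derive t 1 nu (derive1 nu t)].
Proof.
by case: (trajectory_regular2 htraj) => [[_ hx] [_ hu] _ [_ hta]] t0;
  split; apply: is_derive_derive1; [exact: hx|exact: hu|exact: hta].
Qed.

Lemma player1 : player (setX G) (costf G) (L1 G) (psi K) (psiE K) r x u ta
  (fun t => B *m mirror2 t) mirror1 xs us ls (B *m ys).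
Proof.
have [_ _ hX _] := hG; have [hpsi _] := hK; have [he _] := heq.
split => //.
- by move=> i; have [] := hX i.
- by move=> i; have [] := hX i.
- move=> i; have [[D [XD _ sf]] _] := costf_regular hD i.
  by apply: strictly_convex_sub XD _ sf; have [] := hX i.
- move=> i z Xz; have [[D [XD [_ C1] _]] _] := costf_regular hD i.
  by have [] := C1 z (XD z Xz).
- by move=> t i; rewrite block_stack.
- by have [[]] := trajectory_regular1 htraj.
- apply: block_inj => i; rewrite block_stack.
  by have [] := trajectory_init1 htraj i.
- move=> t t0; have [hx _ _] := deriv1 t0; apply: (is_derive_eq hx).
  apply: block_inj => i; have [/(_ i)[-> _ _ _] _] := trajectory_ode htraj t0.
  by rewrite linearZ /= [block i _](linearB (block i)) /= block_stack.
- move=> t t0 _; have [_ hu _] := deriv1 t0; exists (derive1 u t) => // i.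
  have [/(_ i)[_ _ -> _] _] := trajectory_ode htraj t0.
  have [-> -> -> _] := extrapolated t0; rewrite /bracket_u /gradx.
  by rewrite S2_regularized_x grad_addc L1_sym.
- move=> t t0; have [_ _ hta] := deriv1 t0; apply: (is_derive_eq hta).
  apply: block_inj => i; have [/(_ i)[_ _ _ ->] _] := trajectory_ode htraj t0.
  have [-> -> _ _] := extrapolated t0; rewrite /bracket_ta /gradl grad_S2_l.
  by rewrite addrK linearZ.
- move=> i; have [h _ _ _] := he i; apply/eqP; rewrite eq_sym -subr_eq0.
  by rewrite -/(bracket_x K i xs us) h.
- by have [] := hsaddle.
(* Minimality of [xs] is the right saddle inequality with the dual variables frozen at their optimal
   values. *)
move=> z Xz; have [Xxs Yys /(_ z ls ys ms Xz Yys)/andP[_]] := hsaddle.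
have E := S2_regularized_x G ls ys ms.
by rewrite (congr1 (@^~ xs) E) (congr1 (@^~ z) E) L1_sym lerD2r.
Qed.

Lemma player2 : player (setY G) (costg G) (L2 G) (phi K) (phiE K) r y v nu
  (fun t => - (B^T *m mirror1 t)) mirror2 ys vs ms (- (B^T *m xs)).
Proof.
have [_ _ _ hY] := hG; have [_ hphi] := hK; have [_ he] := heq.
have gd j z : setY G j z -> differentiable (costg G j) z.
  move=> Yz; have [[D [YD [_ C1] _]] _] := costg_regular hD j.
  by have [] := C1 z (YD z Yz).
split => //.
- by move=> j; have [] := hY j.
- by move=> j; have [] := hY j.
- move=> j; have [[D [YD _ sf]] _] := costg_regular hD j.
  by apply: strictly_convex_sub YD _ sf; have [] := hY j.
- by move=> t j; rewrite block_stack.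
- by have [[]] := trajectory_regular2 htraj.
- apply: block_inj => j; rewrite block_stack.
  by have [] := trajectory_init2 htraj j.
- move=> t t0; have [hy _ _] := deriv2 t0; apply: (is_derive_eq hy).
  apply: block_inj => j; have [_ /(_ j)[-> _ _ _]] := trajectory_ode htraj t0.
  by rewrite linearZ /= [block j _](linearB (block j)) /= block_stack.
- move=> t t0 Yy; have [_ hv _] := deriv2 t0; exists (derive1 v t) => // j.
  have [_ /(_ j)[_ _ -> _]] := trajectory_ode htraj t0.
  have [-> _ -> ->] := extrapolated t0; rewrite /bracket_v /grady.
  (* Taking the sign out of the gradient requires differentiability at [y t]; the feasibility
     premise of [player_du] provides it. *)
  rewrite S2_regularized_y grad_addc L2_sym grad_opp ?linearN //.
  by apply: regularized_differentiable => i; apply: gd; exact: Yy.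
- move=> t t0; have [_ _ hnu] := deriv2 t0; apply: (is_derive_eq hnu).
  apply: block_inj => j; have [_ /(_ j)[_ _ _ ->]] := trajectory_ode htraj t0.
  have [_ _ -> ->] := extrapolated t0; rewrite /bracket_nu /gradm grad_S2_m.
  by rewrite addrK -linearN opprK linearZ.
- move=> j; have [h _ _ _] := he j; apply/eqP; rewrite eq_sym -subr_eq0.
  by rewrite -/(bracket_y K j ys vs) h.
- by have [] := hsaddle.
move=> z Yz; have [Xxs Yys /(_ xs ls z ms Xxs Yz)/andP[h _]] := hsaddle.
move: h; have E := S2_regularized_y G xs ls ms.
by rewrite (congr1 (@^~ ys) E) (congr1 (@^~ z) E) L2_sym lerD2r lerN2.
Qed.

Let e1 t := excess (f := costf G) (L := L1 G) (x := x) (xs := xs) (ls := ls)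
  (a_ := B *m ys) t.
Let e2 t := excess (f := costg G) (L := L2 G) (x := y) (xs := ys) (ls := ms)
  (a_ := - (B^T *m xs)) t.

(** Since L1 xs = 0 and L2 ys = 0, the terms with [m t] and [l t] vanish, and the coupling value at
    (xs, ys) cancels between the two excesses. *)
Lemma gap_excess t :
  S2 G (x t) ls ys (m t) - S2 G xs (l t) (y t) ms = e1 t + e2 t.
Proof.
rewrite /S2 !payoffE /e1 /e2 /excess /regularized /separable -/B.
rewrite !dotDl !dotNl -!(dot_mulmx B) !(dotC (B *m ys)) !L1_dotC !L2_dotC.
rewrite L1xs L2ys !dot0r.
move: (\sum_i _) (\sum_i _) (\sum_i _) (\sum_i _) => s1 s2 s3 s4.
move: (dot _ _) (dot _ _) (dot _ _) (dot _ _) => w1 w2 w3 w4.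
move: (dot _ _) (dot _ _) (dot _ _) => *; ring.
Qed.

Lemma payoff_separable t :
  payoff G (x t) ys - payoff G xs (y t) =
  (separable (costf G) (B *m ys + L1 G *m ls) (x t) -
   separable (costf G) (B *m ys + L1 G *m ls) xs)
  + (separable (costg G) (- (B^T *m xs) + L2 G *m ms) (y t) -
     separable (costg G) (- (B^T *m xs) + L2 G *m ms) ys)
  - dot ls (L1 G *m x t) - dot ms (L2 G *m y t).
Proof.
rewrite !payoffE /separable -/B.
rewrite !dotDl !dotNl -!(dot_mulmx B) !(dotC (B *m ys)) !L1_dotC !L2_dotC.
rewrite L1xs L2ys !dot0r.
move: (\sum_i _) (\sum_i _) (\sum_i _) (\sum_i _) => s1 s2 s3 s4.
move: (dot _ _) (dot _ _) (dot _ _) (dot _ _) => w1 w2 w3 w4.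
move: (dot _ _) => *; ring.
Qed.

Lemma excess_bound : exists C, forall t, 1 <= t ->
  (t / r) ^+ 2 * e1 t <= C /\ (t / r) ^+ 2 * e2 t <= C.
Proof.
pose V t := lyapunov (f := costf G) (L := L1 G) (h := psi K) (r := r) (x := x)
    (u := u) (ta := ta) (xs := xs) (us := us) (ls := ls) (a_ := B *m ys) t +
  lyapunov (f := costg G) (L := L2 G) (h := phi K) (r := r) (x := y)
    (u := v) (ta := nu) (xs := ys) (us := vs) (ls := ms)
    (a_ := - (B^T *m xs)) t.
have pos t : 1 <= t -> 0 < t :> R by apply: lt_le_trans.
have V1 : forall t, 1 <= t -> V t <= V 1.
  apply: nonincreasing_after => t t0.
  have [d1 h1 le1] := lyapunov_derive player1 t0.
  have [d2 h2 le2] := lyapunov_derive player2 t0.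
  exists (d1 + d2); first exact: is_derive_add h1 h2.
  apply: le_trans (lerD le1 le2) _; rewrite -mulrDr.
  (* The two work terms are opposite: one force is built from B, the other from minus its
     transpose. *)
  rewrite !(dotBl, dotBr, dotNr) !(dot_mulmx B^T) trmxK !(dotC (B *m _)).
  by rewrite [X in _ * X](_ : _ = 0) ?mulr0 //; ring.
exists (V 1) => t t1; have Vt := V1 t t1.
have h1 := excess_le_lyapunov player1 t.
have h2 := excess_le_lyapunov player2 t.
have g1 := excess_ge0 player1 (ltW (pos _ t1)).
have g2 := excess_ge0 player2 (ltW (pos _ t1)).
have sq : 0 <= (t / r) ^+ 2 by exact: sqr_ge0.
(* Both shares of V are nonnegative, so a bound on the sum bounds each excess separately. *)
have p1 := le_trans (mulr_ge0 sq g1) h1.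
have p2 := le_trans (mulr_ge0 sq g2) h2.
split; [apply: le_trans h1 _|apply: le_trans h2 _]; apply: le_trans Vt.
  by rewrite lerDl.
by rewrite lerDr.
Qed.

End Trajectory.

Theorem corollary2 (R : realType) (n1 n2 p q : nat)
    (G : game R n1 n2 p q) (K : generators R n1 n2 p q) (r : R)
    (x u l ta : R -> 'cV[R]_(n1 * p)) (y v m nu : R -> 'cV[R]_(n2 * q))
    (xs us ls tas : 'cV[R]_(n1 * p)) (ys vs ms nus : 'cV[R]_(n2 * q))
    (hr : 2 <= r) (hG : is_game G) (hD : assumptionD G)
    (hK : is_generators G K)
    (htraj : trajectory G K r x u l ta y v m nu)
    (heq : equilibrium_point G K xs us ls tas ys vs ms nus)
    (hsaddle : saddle_point G xs ls ys ms)
    (hnash : nash_equilibrium G xs ys) :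
  [/\ rate_O 2 (fun t => S2 G (x t) ls ys (m t) - S2 G xs (l t) (y t) ms),
      (x t, y t) @[t --> +oo] --> (xs, ys) &
      [/\ rate_O 1 (fun t => enorm (L1 G *m x t)),
          rate_O 1 (fun t => enorm (L2 G *m y t)) &
          rate_O 1 (fun t => `|payoff G (x t) ys - payoff G xs (y t)|)]].
Proof.
have P1 := player1 hr hG hD hK htraj heq hsaddle hnash.
have P2 := player2 hr hG hD hK htraj heq hsaddle hnash.
have [C hC] := excess_bound hr hG hD hK htraj heq hsaddle hnash.
have [cx [N1 hN1] [M1 hM1]] := player_rate P1 (fun t t1 => (hC t t1).1).
have [cy [N2 hN2] [M2 hM2]] := player_rate P2 (fun t t1 => (hC t t1).2).
have pos t : 1 <= t -> 0 < t :> R by apply: lt_le_trans.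
split.
- exists ((C + C) * r ^+ 2); near=> t.
  have t1 : 1 <= t by near: t; exact: nbhs_pinfty_ge.
  rewrite (gap_excess hG hnash) addr_ge0 ?(excess_ge0 P1) ?(excess_ge0 P2)
    ?(ltW (pos _ t1)) //=.
  rewrite ler_pdivlMr ?exprn_gt0 ?pos //.
  have := lerD (hC t t1).1 (hC t t1).2.
  rewrite -mulrDr expr_div_n mulrAC ler_pdivrMr ?exprn_gt0
    ?(lt_le_trans _ hr) //.
  by rewrite mulrC.
- exact: (cvg_pair cx cy).
split.
- exists N1; near=> t; rewrite expr1 enorm_ge0 /=; apply: hN1.
  by near: t; exact: nbhs_pinfty_ge.
- exists N2; near=> t; rewrite expr1 enorm_ge0 /=; apply: hN2.
  by near: t; exact: nbhs_pinfty_ge.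
exists (M1 + M2); near=> t; rewrite expr1 normr_ge0 /=.
have t1 : 1 <= t by near: t; exact: nbhs_pinfty_ge.
rewrite (payoff_separable (ls := ls) (ms := ms) hG hnash) mulrDl.
(* Each cost difference is grouped with the multiplier term of the same player, the combination
   bounded by [player_rate]. *)
have tri (a b c d : R) : `|a + b - c - d| <= `|a| + `|c| + (`|b| + `|d|).
  rewrite addrACA addrA; apply: le_trans (ler_normB _ _) _; rewrite lerD2r.
  by apply: le_trans (ler_normB _ _) _; rewrite lerD2r; exact: ler_normD.
by apply: le_trans (tri _ _ _ _) _; apply: lerD; [exact: hM1|exact: hM2].
Unshelve. all: by end_near. Qed.
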